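(* Let $a<b$, $n\in\mathbb N$, $\alpha=(\alpha_1,\ldots,\alpha_n)$ with $\alpha_j\in(0,1)$, and fix $z_a\in\mathbb R$, $x_a,x_b\in\mathbb R^n$. Call $x=(x_1,\ldots,x_n)$ admissible if $x\in C^1([a,b],\mathbb R^n)$, ${^C_aD^\alpha_t}x:=({^C_aD^{\alpha_1}_t}x_1,\ldots,{^C_aD^{\alpha_n}_t}x_n)\in C^1([a,b],\mathbb R^n)$, $x(a)=x_a$ and $x(b)=x_b$. Let $L:[a,b]\times\mathbb R^{2n+1}\to\mathbb R$, $L=L(t,x,v,z)$, be of class $C^1$. For admissible $x$, let $z[x;\cdot]$ denote the solution of $$\frac{dz}{dt}=L(t,x(t),{^C_aD^\alpha_t}x(t),z(t)),\quad t\in[a,b],\qquad z(a)=z_a,$$ and consider the functional $x\mapsto z[x;b]$. Write $[x,z](t):=(t,x(t),{^C_aD^\alpha_t}x(t),z(t))$ and $\lambda(t):=\exp\left(-\int_a^t\frac{\partial L}{\partial z}[x,z](\tau)\,d\tau\right)$, and assume that for each $j$ the right Riemann–Liouville derivative ${_tD^{\alpha_j}_b}\left(\lambda(t)\frac{\partial L}{\partial {^C_aD^{\alpha_j}_t}x_j}[x,z](t)\right)$ exists and is continuous on $[a,b]$. If $x$ is an admissible function at which $z[x;b]$ attains an extremum (i.e. $\frac{d}{d\epsilon}z[x+\epsilon\eta;b]\big|_{\epsilon=0}=0$ for every $\eta\in C^1([a,b],\mathbb R^n)$ with ${^C_aD^\alpha_t}\eta\in C^1([a,b],\mathbb R^n)$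 and $\eta(a)=\eta(b)=0$), then for all $t\in[a,b]$ and $j=1,\ldots,n$, $$\lambda(t)\frac{\partial L}{\partial x_j}[x,z](t)+{_tD^{\alpha_j}_b}\left(\lambda(t)\frac{\partial L}{\partial {^C_aD^{\alpha_j}_t}x_j}[x,z](t)\right)=0,$$ where $\frac{\partial L}{\partial x_j}$, $\frac{\partial L}{\partial {^C_aD^{\alpha_j}_t}x_j}$, $\frac{\partial L}{\partial z}$ denote the partial derivatives of $L$ with respect to the $j$-th component of its second argument, the $j$-th component of its third argument, and its last argument, respectively.
   Context: For $\alpha\in(0,1)$ and $f:[a,b]\to\mathbb R$: the left Caputo derivative is ${^C_aD^\alpha_t}f(t)=\frac{1}{\Gamma(1-\alpha)}\int_a^t(t-\tau)^{-\alpha}f'(\tau)\,d\tau$; the right Riemann–Liouville integral is ${_tI^{\alpha}_b}f(t)=\frac{1}{\Gamma(\alpha)}\int_t^b(\tau-t)^{\alpha-1}f(\tau)\,d\tau$; the right Riemann–Liouville derivative is ${_tD^\alpha_b}f(t)=\frac{-1}{\Gamma(1-\alpha)}\frac{d}{dt}\int_t^b(\tau-t)^{-\alpha}f(\tau)\,d\tau$. The solution $z[x;t]$ is assumed to exist on $[a,b]$ and to depend differentiably on a parameter $\epsilon$ when $x$ is replaced by $x+\epsilon\eta$; the initial value $z(a)=z_a$ is the same for all argument functions. *)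

(* Defs.v *)
From Stdlib Require Import Reals.
From Coquelicot Require Import Coquelicot.
From mathcomp Require Import ssreflect ssrbool eqtype ssrnat fintype.

Open Scope R_scope.

Definition Rvec (n : nat) := 'I_n -> R.

Definition upd {n : nat} (x : Rvec n) (j : 'I_n) (s : R) : Rvec n :=
  fun k => if k == j then s else x k.

Definition Gamma (s : R) : R :=
  RInt_gen (fun t => Rpower t (s - 1) * exp (- t)) (at_right 0) (Rbar_locally p_infty).

Definition int_sing_right (g : R -> R) (a t : R) : R :=
  match Rlt_dec a t with
  | left _ => RInt_gen g (at_point a) (at_left t)
  | right _ => 0
  end.

Definition int_sing_left (g : R -> R) (t b : R) : R :=
  match Rlt_dec t b with
  | left _ => RInt_gen g (at_right t) (at_point b)
  | right _ => 0
  end.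

Definition caputo (alpha a : R) (f : R -> R) (t : R) : R :=
  / Gamma (1 - alpha) *
  int_sing_right (fun tau => Rpower (t - tau) (- alpha) * Derive f tau) a t.

Definition has_deriv_within (a b : R) (f : R -> R) (t l : R) : Prop :=
  forall eps : R, 0 < eps -> exists delta : R, 0 < delta /\
    forall s : R, a <= s <= b -> Rabs (s - t) < delta ->
      Rabs (f s - f t - l * (s - t)) <= eps * Rabs (s - t).

Definition cont_on (a b : R) (g : R -> R) : Prop :=
  forall t : R, a <= t <= b -> forall eps : R, 0 < eps -> exists delta : R, 0 < delta /\
    forall s : R, a <= s <= b -> Rabs (s - t) < delta -> Rabs (g s - g t) < eps.

Definition C1_on (a b : R) (f : R -> R) : Prop :=
  exists f' : R -> R, cont_on a b f' /\
    forall t : R, a <= t <= b -> has_deriv_within a b f t (f' t).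

Definition C1_vec_on {n : nat} (a b : R) (x : R -> Rvec n) : Prop :=
  forall j : 'I_n, C1_on a b (fun t => x t j).

Definition caputo_vec {n : nat} (alpha : Rvec n) (a : R) (x : R -> Rvec n) : R -> Rvec n :=
  fun t j => caputo (alpha j) a (fun s => x s j) t.

Definition Lagr (n : nat) := R -> Rvec n -> Rvec n -> R -> R.

Definition jcont_on {n : nat} (a b : R) (g : Lagr n) : Prop :=
  forall t x v z, a <= t <= b -> forall eps : R, 0 < eps -> exists delta : R, 0 < delta /\
    forall t' x' v' z', a <= t' <= b -> Rabs (t' - t) < delta ->
      (forall k, Rabs (x' k - x k) < delta) -> (forall k, Rabs (v' k - v k) < delta) ->
      Rabs (z' - z) < delta ->
      Rabs (g t' x' v' z' - g t x v z) < eps.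

Definition dLx {n : nat} (L : Lagr n) (j : 'I_n) : Lagr n :=
  fun t x v z => Derive (fun s => L t (upd x j s) v z) (x j).
Definition dLv {n : nat} (L : Lagr n) (j : 'I_n) : Lagr n :=
  fun t x v z => Derive (fun s => L t x (upd v j s) z) (v j).
Definition dLz {n : nat} (L : Lagr n) : Lagr n :=
  fun t x v z => Derive (fun s => L t x v s) z.

Definition C1_Lagr {n : nat} (a b : R) (L : Lagr n) : Prop :=
  jcont_on a b L /\
  (exists Lt : Lagr n, jcont_on a b Lt /\
     forall t x v z, a <= t <= b -> has_deriv_within a b (fun s => L s x v z) t (Lt t x v z)) /\
  (forall j : 'I_n, (forall t x v z, a <= t <= b -> ex_derive (fun s => L t (upd x j s) v z) (x j))
                    /\ jcont_on a b (dLx L j)) /\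
  (forall j : 'I_n, (forall t x v z, a <= t <= b -> ex_derive (fun s => L t x (upd v j s) z) (v j))
                    /\ jcont_on a b (dLv L j)) /\
  ((forall t x v z, a <= t <= b -> ex_derive (fun s => L t x v s) z) /\ jcont_on a b (dLz L)).

Definition admissible {n : nat} (alpha : Rvec n) (a b : R) (xa xb : Rvec n)
  (x : R -> Rvec n) : Prop :=
  C1_vec_on a b x /\ C1_vec_on a b (caputo_vec alpha a x) /\ x a = xa /\ x b = xb.

Definition variation {n : nat} (alpha : Rvec n) (a b : R) (eta : R -> Rvec n) : Prop :=
  C1_vec_on a b eta /\ C1_vec_on a b (caputo_vec alpha a eta) /\
  (forall j, eta a j = 0) /\ (forall j, eta b j = 0).

Definition perturb {n : nat} (x eta : R -> Rvec n) (eps : R) : R -> Rvec n :=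
  fun t j => x t j + eps * eta t j.

Definition is_solution {n : nat} (L : Lagr n) (alpha : Rvec n) (a b za : R)
  (x : R -> Rvec n) (z : R -> R) : Prop :=
  z a = za /\ forall t, a <= t <= b ->
    has_deriv_within a b z t (L t (x t) (caputo_vec alpha a x t) (z t)).

(** Right Riemann--Liouville derivative: D is the right RL derivative of order
    alpha of f on [a,b], i.e. for t in [a,b]
    D t = -(1/Gamma(1-alpha)) d/dt int_t^b (tau-t)^(-alpha) f(tau) dtau
    (derivative relative to [a,b]). *)
Definition is_right_RL_deriv (alpha a b : R) (f D : R -> R) : Prop :=
  forall t, a <= t <= b ->
    has_deriv_within a b
      (fun s => int_sing_left (fun tau => Rpower (tau - s) (- alpha) * f tau) s b)
      t (- Gamma (1 - alpha) * D t).

(* Main.v *)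
Require Import Defs.
From Stdlib Require Import Reals Lra ClassicalEpsilon FunctionalExtensionality.
From Coquelicot Require Import Coquelicot.
From mathcomp Require Import ssreflect ssrbool eqtype ssrnat fintype seq.
Set Bullet Behavior "Strict Subproofs".
Open Scope R_scope.

(** Perturbing only the j-th coordinate, x + eps h e_j, the difference of the solutions obeys a
    linear ODE up to o(eps), uniformly in t because L is C^1 near the compact graph of the
    solution. Multiplying by the integrating factor lambda gives
    lambda(b) dz/deps(b) = int_a^b lambda (L_{x_j} h + L_{v_j} D^alpha h).
    The right-hand side thus vanishes for every test function h, fractional integration by parts
    turns it into int_a^b (lambda L_{x_j} + D_b^alpha(lambda L_{v_j})) h, and bump functions
    conclude. The substitution r = s^(1-alpha)/(1-alpha) makes the weakly singular integrals
    proper, and applying Fubini to the continuous kernel s^(1-alpha)/(1-alpha) against h'' instead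
    of s^(-alpha) against h' keeps all double integrals continuous. *)

(** * Calculus on a closed interval *)

(** The function lambda L_{v_j} is merely continuous: its right Riemann-Liouville derivative [D] is
    the only differentiability available, so no other derivative may fall on it. It is therefore
    integrated instead: if Q' = q and Q(b) = 0, the singular integral G of Q satisfies G' = J, the
    singular integral of q, and J' = - Gamma(1-alpha) D. This chain of two derivatives is what h''
    is matched against.

    Smoothness of h alone does not make its Caputo derivative C^1 on [a,b]: for h(t) = t - a it is a
    multiple of (t-a)^(1-alpha), whose slope blows up at a. Hence the test functions are C^3 bumps
    supported strictly inside (a,b). This also keeps away from b, where the kernel s^(1-alpha) is
    not differentiable; the equation at the endpoints is recovered from continuity.

    Computing the first variation by exchanging d/dt and d/deps would require joint regularity in
    (t, eps). The difference of two solutions is estimated instead, in two passes: a crude Gronwall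
    bound makes it O(eps), and only then does the C^1 expansion of L make the linearisation error
    o(eps). *)

Lemma continuous_eps (f : R -> R) (x : R) :
  continuous f x <->
  forall eps, 0 < eps -> exists delta, 0 < delta /\
    forall y, Rabs (y - x) < delta -> Rabs (f y - f x) < eps.
Proof.
  split.
  - intros H eps Heps.
    destruct (proj1 (filterlim_locally f (f x)) H (mkposreal eps Heps)) as [d Hd].
    exists d; split; [apply cond_pos|]. intros y Hy. exact (Hd y Hy).
  - intros H. apply filterlim_locally. intros [e He].
    destruct (H e He) as [d [Hd Hy]].
    exists (mkposreal d Hd). exact Hy.
Qed.

Lemma is_derive_eps (f : R -> R) (x l : R) :
  is_derive f x l <->
  forall eps, 0 < eps -> exists delta, 0 < delta /\
    forall y, Rabs (y - x) < delta -> Rabs (f y - f x - l * (y - x)) <= eps * Rabs (y - x).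
Proof.
  split.
  - intros [_ H] eps Heps.
    destruct (H x (fun P HP => HP) (mkposreal eps Heps)) as [d Hd].
    exists d; split; [apply cond_pos|]. intros y Hy.
    generalize (Hd y Hy). unfold norm, minus, plus, opp, scal; simpl.
    unfold abs, mult; simpl. intros K.
    replace (f y - f x - l * (y - x)) with (f y + - f x + - ((y + - x) * l)) by ring.
    exact K.
  - intros H. split; [apply is_linear_scal_l|].
    intros y Hy.
    apply (is_filter_lim_locally_unique (V := R_NormedModule)) in Hy. rewrite -Hy.
    intros [e He]. destruct (H e He) as [d [Hd Hs]].
    exists (mkposreal d Hd). intros s Hb.
    generalize (Hs s Hb). unfold norm, minus, plus, opp, scal; simpl.
    unfold abs, mult; simpl. intros K.
    replace (f s + - f x + - ((s + - x) * l)) with (f s - f x - l * (s - x)) by ring.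
    exact K.
Qed.

Lemma is_derive_continuous (f : R -> R) (x l : R) : is_derive f x l -> continuous f x.
Proof. intros H. apply (ex_derive_continuous (V := R_NormedModule) f x). exists l. exact H. Qed.

Lemma is_derive_eq (f : R -> R) (x l l' : R) : l = l' -> is_derive f x l -> is_derive f x l'.
Proof. now intros <-. Qed.

(** Projection onto [a,b]. Being 1-Lipschitz and the identity on [a,b], it turns relative continuity
    on [a,b] into the two-sided continuity on R that [continuous] expresses. *)
Definition clamp (a b t : R) : R := Rmax a (Rmin b t).

Lemma clamp_id a b t : a <= t <= b -> clamp a b t = t.
Proof. intros H. unfold clamp, Rmax, Rmin. repeat destruct Rle_dec; lra. Qed.

Lemma clamp_bounds a b t : a <= b -> a <= clamp a b t <= b.
Proof. intros H. unfold clamp, Rmax, Rmin. repeat destruct Rle_dec; lra. Qed.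

Lemma clamp_lipschitz a b s t : Rabs (clamp a b s - clamp a b t) <= Rabs (s - t).
Proof.
  unfold clamp, Rmax, Rmin, Rabs.
  repeat destruct Rle_dec; repeat destruct Rcase_abs; lra.
Qed.

Lemma cont_on_extend a b g : a <= b -> cont_on a b g ->
  exists G : R -> R, (forall t, continuous G t) /\ (forall t, a <= t <= b -> G t = g t).
Proof.
  intros Hab Hg. exists (fun t => g (clamp a b t)). split.
  - intros t. apply continuous_eps. intros eps Heps.
    destruct (Hg _ (clamp_bounds a b t Hab) eps Heps) as [d [Hd Hs]].
    exists d; split; [exact Hd|]. intros y Hy. apply Hs; [now apply clamp_bounds|].
    eapply Rle_lt_trans; [apply clamp_lipschitz|exact Hy].
  - intros t Ht. now rewrite clamp_id.
Qed.

Lemma continuous_cont_on a b g : (forall t, a <= t <= b -> continuous g t) -> cont_on a b g.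
Proof.
  intros H t Ht eps Heps.
  destruct (proj1 (continuous_eps g t) (H t Ht) eps Heps) as [d [Hd Hs]].
  exists d; split; [exact Hd|]. intros s _ Hst. now apply Hs.
Qed.

Lemma cont_on_ext a b f g :
  (forall t, a <= t <= b -> f t = g t) -> cont_on a b f -> cont_on a b g.
Proof.
  intros E H t Ht eps Heps. destruct (H t Ht eps Heps) as [d [Hd Hs]].
  exists d; split; [exact Hd|]. intros s Hsb Hst. rewrite <- !E by assumption. now apply Hs.
Qed.

Lemma has_deriv_within_cont a b f t l :
  has_deriv_within a b f t l ->
  forall eps, 0 < eps -> exists delta, 0 < delta /\
    forall s, a <= s <= b -> Rabs (s - t) < delta -> Rabs (f s - f t) < eps.
Proof.
  intros H eps Heps. destruct (H 1 Rlt_0_1) as [d [Hd Hs]].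
  assert (Hl : 0 < Rabs l + 1) by (generalize (Rabs_pos l); lra).
  exists (Rmin d (eps / (Rabs l + 1))). split.
  { apply Rmin_pos; [exact Hd|]. now apply Rdiv_lt_0_compat. }
  intros s Hsb Hst.
  generalize (Hs s Hsb (Rlt_le_trans _ _ _ Hst (Rmin_l _ _))). intros K.
  assert (K2 : Rabs (s - t) * (Rabs l + 1) < eps).
  { apply (Rlt_le_trans _ (eps / (Rabs l + 1) * (Rabs l + 1))).
    - apply Rmult_lt_compat_r; [exact Hl|].
      exact (Rlt_le_trans _ _ _ Hst (Rmin_r _ _)).
    - right. field. lra. }
  replace (f s - f t) with ((f s - f t - l * (s - t)) + l * (s - t)) by ring.
  eapply Rle_lt_trans; [apply Rabs_triang|]. rewrite Rabs_mult. lra.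
Qed.

Lemma is_derive_within a b f t l : is_derive f t l -> has_deriv_within a b f t l.
Proof.
  intros H eps Heps. destruct (proj1 (is_derive_eps f t l) H eps Heps) as [d [Hd Hs]].
  exists d; split; [exact Hd|]. intros s _. apply Hs.
Qed.

Lemma at_left_interval a t : a < t -> at_left t (fun x => a < x < t).
Proof.
  intros H. exists (mkposreal _ (proj2 (Rlt_0_minus _ _) H)). intros y Hy Hyt.
  unfold ball in Hy; simpl in Hy. unfold AbsRing_ball, abs, minus, plus, opp in Hy; simpl in Hy.
  apply Rabs_def2 in Hy. lra.
Qed.

Lemma at_right_interval t b : t < b -> at_right t (fun x => t < x < b).
Proof.
  intros H. exists (mkposreal _ (proj2 (Rlt_0_minus _ _) H)). intros y Hy Hyt.
  unfold ball in Hy; simpl in Hy. unfold AbsRing_ball, abs, minus, plus, opp in Hy; simpl in Hy.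
  apply Rabs_def2 in Hy. lra.
Qed.

Lemma within_is_derive a b f t l :
  a < t < b -> has_deriv_within a b f t l -> is_derive f t l.
Proof.
  intros Ht H. apply is_derive_eps. intros eps Heps. destruct (H eps Heps) as [d [Hd Hs]].
  exists (Rmin d (Rmin (t - a) (b - t))). split.
  { repeat apply Rmin_pos; lra. }
  intros s Hst. apply Hs; [|exact (Rlt_le_trans _ _ _ Hst (Rmin_l _ _))].
  generalize (Rlt_le_trans _ _ _ Hst (Rmin_r _ _)). intros K.
  generalize (Rlt_le_trans _ _ _ K (Rmin_r _ _)) (Rlt_le_trans _ _ _ K (Rmin_l _ _)).
  intros K1 K2. apply Rabs_def2 in K1. apply Rabs_def2 in K2. lra.
Qed.

Lemma has_deriv_within_ext a b f g t l :
  a <= t <= b -> (forall s, a <= s <= b -> f s = g s) ->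
  has_deriv_within a b f t l -> has_deriv_within a b g t l.
Proof.
  intros Ht E H eps Heps. destruct (H eps Heps) as [d [Hd Hs]].
  exists d; split; [exact Hd|]. intros s Hsb Hst. rewrite <- !E by assumption. now apply Hs.
Qed.

(** Holds at the endpoints too, since a nondegenerate interval has points arbitrarily close to t on
    at least one side. It later identifies all right Riemann-Liouville derivatives of the same
    function. *)
Lemma has_deriv_within_unique a b f t l1 l2 : a < b -> a <= t <= b ->
  has_deriv_within a b f t l1 -> has_deriv_within a b f t l2 -> l1 = l2.
Proof.
  intros Hab Ht H1 H2.
  destruct (Req_dec l1 l2) as [E|N]; [exact E|exfalso].
  assert (He : 0 < Rabs (l1 - l2) / 4).
  { apply Rdiv_lt_0_compat; [apply Rabs_pos_lt|]; lra. }
  destruct (H1 _ He) as [d1 [Hd1 K1]]. destruct (H2 _ He) as [d2 [Hd2 K2]].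
  (* As d is at most half of b - a, one of t + d and t - d lies in [a,b]. *)
  set (d := Rmin (Rmin d1 d2) (b - a) / 2).
  assert (Hm : 0 < Rmin (Rmin d1 d2) (b - a)) by (repeat apply Rmin_pos; lra).
  generalize (Rmin_l (Rmin d1 d2) (b - a)) (Rmin_r (Rmin d1 d2) (b - a))
    (Rmin_l d1 d2) (Rmin_r d1 d2). intros M1 M2 M3 M4.
  assert (exists s, a <= s <= b /\ Rabs (s - t) = d) as [s [Hs E]].
  { destruct (Rle_dec (t + d) b) as [L|L].
    - exists (t + d). unfold d in *. split; [lra|].
      replace (t + _ - t) with (Rmin (Rmin d1 d2) (b - a) / 2) by ring.
      apply Rabs_right. lra.
    - exists (t - d). unfold d in *. split; [lra|].
      replace (t - _ - t) with (- (Rmin (Rmin d1 d2) (b - a) / 2)) by ring.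
      rewrite Rabs_Ropp. apply Rabs_right. lra. }
  assert (S1 : Rabs (s - t) < d1) by (rewrite E; unfold d; lra).
  assert (S2 : Rabs (s - t) < d2) by (rewrite E; unfold d; lra).
  generalize (K1 s Hs S1) (K2 s Hs S2). intros A B.
  assert (C : Rabs ((l1 - l2) * (s - t)) <= 2 * (Rabs (l1 - l2) / 4 * Rabs (s - t))).
  { replace ((l1 - l2) * (s - t)) with
      ((f s - f t - l2 * (s - t)) - (f s - f t - l1 * (s - t))) by ring.
    unfold Rminus at 1. eapply Rle_trans; [apply Rabs_triang|]. rewrite Rabs_Ropp. lra. }
  rewrite Rabs_mult in C.
  assert (0 < Rabs (l1 - l2) * Rabs (s - t)).
  { apply Rmult_lt_0_compat; [apply Rabs_pos_lt; lra|]. rewrite E; unfold d; lra. }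
  lra.
Qed.

Lemma ex_RInt_cont (f : R -> R) a b : (forall t, continuous f t) -> ex_RInt f a b.
Proof. intros H. apply (ex_RInt_continuous (V := R_CompleteNormedModule)). intros; apply H. Qed.

Lemma continuous_affine (f g : R -> R) e t :
  continuous f t -> continuous g t -> continuous (fun t => f t + e * g t) t.
Proof.
  intros Hf Hg.
  apply (continuous_plus (U := R_UniformSpace) (V := R_NormedModule) f (fun t => e * g t)); [exact Hf|].
  now apply (continuous_mult (K := R_AbsRing) (fun _ => e) g); [apply continuous_const|].
Qed.

Lemma is_derive_prim (f : R -> R) a t :
  (forall s, continuous f s) -> is_derive (fun T => RInt f a T) t (f t).
Proof.
  intros H. apply (is_derive_RInt f (fun T => RInt f a T) a); [|apply H].
  exists (mkposreal 1 Rlt_0_1). intros y _. apply (RInt_correct f). now apply ex_RInt_cont.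
Qed.

Lemma deriv_zero_const (f : R -> R) a b : a <= b ->
  (forall t, a < t < b -> is_derive f t 0) ->
  (forall t, a <= t <= b -> continuous f t) -> f b = f a.
Proof.
  intros Hab Hd Hc.
  destruct (MVT_gen f a b (fun _ => 0)) as [c [_ E]].
  - intros t Ht. rewrite Rmin_left in Ht; [|lra]. rewrite Rmax_right in Ht; [|lra]. now apply Hd.
  - intros t Ht. rewrite Rmin_left in Ht; [|lra]. rewrite Rmax_right in Ht; [|lra].
    apply continuity_pt_filterlim. now apply Hc.
  - lra.
Qed.

(** The derivative is extended first and then integrated from a: clamping f itself would create
    corners at a and b. *)
Lemma C1_extend a b f f' : a < b -> cont_on a b f' ->
  (forall t, a <= t <= b -> has_deriv_within a b f t (f' t)) ->
  exists F F' : R -> R,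
    (forall t, is_derive F t (F' t)) /\ (forall t, continuous F' t) /\
    (forall t, a <= t <= b -> F t = f t) /\ (forall t, a <= t <= b -> F' t = f' t).
Proof.
  intros Hab Hc Hd.
  destruct (cont_on_extend a b f' (Rlt_le _ _ Hab) Hc) as [F' [HF' EF']].
  assert (Hcf : cont_on a b f).
  { intros t Ht. exact (has_deriv_within_cont a b f t _ (Hd t Ht)). }
  destruct (cont_on_extend a b f (Rlt_le _ _ Hab) Hcf) as [G [HG EG]].
  exists (fun t => f a + RInt F' a t), F'.
  assert (HD : forall t, is_derive (fun t => f a + RInt F' a t) t (F' t)).
  { intros t. replace (F' t) with (0 + F' t) by ring.
    apply (is_derive_plus (fun _ => f a) (fun T => RInt F' a T) t).
    - apply @is_derive_const.
    - now apply is_derive_prim. }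
  split; [exact HD|]. split; [exact HF'|]. split; [|exact EF'].
  intros t Ht.
  assert (K : G t - (f a + RInt F' a t) = G a - (f a + RInt F' a a)).
  { apply (deriv_zero_const (fun t => G t - (f a + RInt F' a t)) a t); [lra| |].
    - intros s Hs. replace 0 with (F' s - F' s) by ring.
      apply (is_derive_minus G (fun t => f a + RInt F' a t)); [|apply HD].
      apply (within_is_derive a b); [lra|]. rewrite EF'; [|lra].
      apply (has_deriv_within_ext a b f); [lra| |apply Hd; lra].
      intros; symmetry; now apply EG.
    - intros s Hs. apply (continuous_minus G (fun t => f a + RInt F' a t)); [apply HG|].
      exact (is_derive_continuous _ _ _ (HD s)). }
  rewrite RInt_point in K. rewrite !EG in K; [|lra|lra]. unfold zero in K; simpl in K. lra.
Qed.

Lemma is_derive_C1_on a b f f' :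
  (forall t, a <= t <= b -> is_derive f t (f' t)) -> (forall t, a <= t <= b -> continuous f' t) ->
  C1_on a b f.
Proof.
  intros Hd Hc. exists f'. split; [now apply continuous_cont_on|].
  intros t Ht. now apply is_derive_within, Hd.
Qed.

Lemma C1_on_ext a b f g :
  (forall t, a <= t <= b -> f t = g t) -> C1_on a b f -> C1_on a b g.
Proof.
  intros E [f' [Hc Hd]]. exists f'. split; [exact Hc|]. intros t Ht.
  apply (has_deriv_within_ext a b f); auto.
Qed.

Lemma C1_on_cont a b f : C1_on a b f -> cont_on a b f.
Proof. intros [f' [_ Hd]] t Ht. exact (has_deriv_within_cont a b f t _ (Hd t Ht)). Qed.

Lemma RInt_of_derive (F f : R -> R) a b :
  (forall t, Rmin a b <= t <= Rmax a b -> is_derive F t (f t)) ->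
  (forall t, Rmin a b <= t <= Rmax a b -> continuous f t) ->
  RInt f a b = F b - F a.
Proof.
  intros Hd Hc. apply is_RInt_unique.
  exact (is_RInt_derive (V := R_CompleteNormedModule) F f a b Hd Hc).
Qed.

(** * Weakly singular integrals *)

(* Rpower s beta is 1 for s <= 0, hence the explicit truncation. *)
Definition powp (beta s : R) : R := if Rlt_dec 0 s then Rpower s beta else 0.

Lemma powp_pos beta s : 0 < s -> powp beta s = Rpower s beta.
Proof. intros H. unfold powp. destruct Rlt_dec; [reflexivity|lra]. Qed.

Lemma powp_neg beta s : s <= 0 -> powp beta s = 0.
Proof. intros H. unfold powp. destruct Rlt_dec; [lra|reflexivity]. Qed.

Lemma powp_derive beta s : 0 < s -> is_derive (powp beta) s (beta * Rpower s (beta - 1)).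
Proof.
  intros Hs. apply (is_derive_ext_loc (fun u => Rpower u beta)).
  - exists (mkposreal s Hs). intros y Hy. symmetry. apply powp_pos.
    apply Rabs_def2 in Hy. unfold minus, plus, opp in Hy; simpl in Hy. lra.
  - apply is_derive_Reals. now apply derivable_pt_lim_power.
Qed.

Lemma powp_continuous beta s : 0 < beta -> continuous (powp beta) s.
Proof.
  intros Hb. destruct (Rtotal_order s 0) as [H|[H|H]].
  - apply continuous_eps. intros eps He. exists (- s). split; [lra|].
    intros y Hy. apply Rabs_def2 in Hy. rewrite !powp_neg; [|lra|lra].
    rewrite Rminus_diag Rabs_R0. exact He.
  (* The radius is the solution delta of delta^beta = eps. *)
  - subst s. apply continuous_eps. intros eps He. exists (Rpower eps (/ beta)).
    split; [apply exp_pos|]. intros y Hy. rewrite (powp_neg beta 0); [|lra].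
    rewrite Rminus_0_r in Hy. rewrite Rminus_0_r.
    destruct (Rle_dec y 0) as [L|L].
    + rewrite powp_neg; [|lra]. rewrite Rabs_R0. exact He.
    + rewrite powp_pos; [|lra]. rewrite Rabs_pos_eq; [|left; apply exp_pos].
      rewrite Rabs_pos_eq in Hy; [|lra].
      replace eps with (Rpower (Rpower eps (/ beta)) beta).
      * apply Rlt_Rpower_l; lra.
      * rewrite Rpower_mult Rinv_l; [|lra]. now apply Rpower_1.
  - exact (is_derive_continuous _ _ _ (powp_derive beta s H)).
Qed.

(** The primitive of s^(-alpha) vanishing at 0, and its inverse; substituting r = kern alpha s
    turns weakly singular integrals into integrals of continuous functions. *)
Definition kern (alpha s : R) : R := powp (1 - alpha) s / (1 - alpha).
Definition kinv (alpha r : R) : R := powp (/ (1 - alpha)) ((1 - alpha) * r).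

Lemma kern_derive alpha s : alpha < 1 -> 0 < s -> is_derive (kern alpha) s (Rpower s (- alpha)).
Proof.
  intros Ha Hs. unfold kern, Rdiv.
  replace (Rpower s (- alpha)) with (((1 - alpha) * Rpower s (1 - alpha - 1)) * / (1 - alpha)).
  - apply (is_derive_scal_l (powp (1 - alpha)) s _ (/ (1 - alpha))). now apply powp_derive.
  - replace (1 - alpha - 1) with (- alpha) by ring. field. lra.
Qed.

Lemma kern_continuous alpha s : alpha < 1 -> continuous (kern alpha) s.
Proof.
  intros Ha. unfold kern, Rdiv.
  apply (continuous_mult (K := R_AbsRing) (powp (1 - alpha)) (fun _ => / (1 - alpha))).
  - apply powp_continuous. lra.
  - apply continuous_const.
Qed.

Lemma kern_neg alpha s : s <= 0 -> kern alpha s = 0.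
Proof. intros H. unfold kern. rewrite powp_neg; [|exact H]. unfold Rdiv; ring. Qed.

Lemma kern_pos alpha s : alpha < 1 -> 0 < s -> 0 < kern alpha s.
Proof.
  intros Ha H. unfold kern. rewrite powp_pos; [|exact H].
  apply Rdiv_lt_0_compat; [apply exp_pos|lra].
Qed.

Lemma kinv_continuous alpha r : alpha < 1 -> continuous (kinv alpha) r.
Proof.
  intros Ha. unfold kinv.
  apply (continuous_comp (fun r => (1 - alpha) * r) (powp (/ (1 - alpha)))).
  - apply (continuous_mult (K := R_AbsRing) (fun _ => 1 - alpha) (fun r => r)).
    + apply continuous_const.
    + apply continuous_id.
  - apply powp_continuous. apply Rinv_0_lt_compat. lra.
Qed.

Lemma kinv_kern alpha s : alpha < 1 -> 0 < s -> kinv alpha (kern alpha s) = s.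
Proof.
  intros Ha Hs. unfold kinv, kern. rewrite (powp_pos _ s Hs).
  replace ((1 - alpha) * (Rpower s (1 - alpha) / (1 - alpha))) with (Rpower s (1 - alpha))
    by (field; lra).
  rewrite powp_pos; [|apply exp_pos]. rewrite Rpower_mult Rinv_r; [|lra]. now apply Rpower_1.
Qed.

Lemma Rpower_continuous beta s : 0 < s -> continuous (fun u => Rpower u beta) s.
Proof.
  intros Hs. apply (is_derive_continuous _ _ (beta * Rpower s (beta - 1))).
  apply is_derive_Reals. now apply derivable_pt_lim_power.
Qed.

(** Convergence at the singular endpoint comes entirely from a primitive that remains continuous
    there; g itself may blow up at t. *)
Lemma is_RInt_gen_at_left (g Th : R -> R) a t : a < t ->
  (forall T, a <= T < t -> is_derive Th T (g T)) ->
  (forall T, a <= T < t -> continuous g T) -> continuous Th t ->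
  is_RInt_gen g (at_point a) (at_left t) (Th t - Th a).
Proof.
  intros Hat Hd Hc Ht. apply filterlimi_locally. intros [e He].
  destruct (proj1 (continuous_eps Th t) Ht e He) as [d [Hd0 Hs]].
  apply (Filter_prod _ _ _ (fun x => x = a) (fun T => a < T < t /\ Rabs (Th T - Th t) < e)).
  - reflexivity.
  - exists (mkposreal _ (Rmin_pos d (t - a) Hd0 (proj2 (Rlt_0_minus _ _) Hat))). intros y Hy Hyt.
    unfold ball in Hy; simpl in Hy. unfold AbsRing_ball, abs, minus, plus, opp in Hy; simpl in Hy.
    generalize (Rlt_le_trans _ _ _ Hy (Rmin_l _ _)) (Rlt_le_trans _ _ _ Hy (Rmin_r _ _)).
    intros K1 K2. split; [apply Rabs_def2 in K2; lra|now apply Hs].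
  - intros x T -> [HT HT2]. exists (Th T - Th a). split.
    + apply (is_RInt_derive (V := R_CompleteNormedModule) Th g); simpl;
      rewrite Rmin_left; try lra; rewrite Rmax_right; try lra; intros; [apply Hd|apply Hc]; lra.
    + unfold ball; simpl. unfold AbsRing_ball, abs, minus, plus, opp; simpl.
      replace (Th T - Th a + - (Th t - Th a)) with (Th T - Th t) by ring. exact HT2.
Qed.

Lemma is_RInt_gen_at_right (g Th : R -> R) t b : t < b ->
  (forall T, t < T <= b -> is_derive Th T (g T)) ->
  (forall T, t < T <= b -> continuous g T) -> continuous Th t ->
  is_RInt_gen g (at_right t) (at_point b) (Th b - Th t).
Proof.
  intros Htb Hd Hc Ht. apply filterlimi_locally. intros [e He].
  destruct (proj1 (continuous_eps Th t) Ht e He) as [d [Hd0 Hs]].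
  apply (Filter_prod _ _ _ (fun T => t < T < b /\ Rabs (Th T - Th t) < e) (fun x => x = b)).
  - exists (mkposreal _ (Rmin_pos d (b - t) Hd0 (proj2 (Rlt_0_minus _ _) Htb))). intros y Hy Hyt.
    unfold ball in Hy; simpl in Hy. unfold AbsRing_ball, abs, minus, plus, opp in Hy; simpl in Hy.
    generalize (Rlt_le_trans _ _ _ Hy (Rmin_l _ _)) (Rlt_le_trans _ _ _ Hy (Rmin_r _ _)).
    intros K1 K2. split; [apply Rabs_def2 in K2; lra|now apply Hs].
  - reflexivity.
  - intros T x [HT HT2] ->. exists (Th b - Th T). split.
    + apply (is_RInt_derive (V := R_CompleteNormedModule) Th g); simpl;
      rewrite Rmin_left; try lra; rewrite Rmax_right; try lra; intros; [apply Hd|apply Hc]; lra.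
    + unfold ball; simpl. unfold AbsRing_ball, abs, minus, plus, opp; simpl.
      replace (Th b - Th T + - (Th b - Th t)) with (- (Th T - Th t)) by ring.
      rewrite Rabs_Ropp. exact HT2.
Qed.

Lemma is_derive_RInt_kern (phi : R -> R) alpha s : alpha < 1 -> 0 < s ->
  (forall r, continuous phi r) ->
  is_derive (fun s => RInt phi 0 (kern alpha s)) s (Rpower s (- alpha) * phi (kern alpha s)).
Proof.
  intros Ha Hs Hc.
  apply (is_derive_comp (fun r => RInt phi 0 r) (kern alpha)); [|now apply kern_derive].
  now apply is_derive_prim.
Qed.

Lemma continuous_RInt_kern (phi : R -> R) alpha s : alpha < 1 -> (forall r, continuous phi r) ->
  continuous (fun s => RInt phi 0 (kern alpha s)) s.
Proof.
  intros Ha Hc. apply (continuous_comp (kern alpha) (fun r => RInt phi 0 r)).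
  - now apply kern_continuous.
  - exact (is_derive_continuous _ _ _ (is_derive_prim phi 0 _ Hc)).
Qed.

Lemma continuous_shift_kinv (f : R -> R) alpha t r : alpha < 1 -> (forall s, continuous f s) ->
  continuous (fun r => f (t + kinv alpha r)) r.
Proof.
  intros Ha Hf. apply (continuous_comp (fun r => t + kinv alpha r) f); [|apply Hf].
  apply (continuous_plus (fun _ => t) (kinv alpha)); [apply continuous_const|].
  now apply kinv_continuous.
Qed.

Lemma is_RInt_gen_sing_left (f : R -> R) alpha t b : alpha < 1 -> t < b ->
  (forall s, continuous f s) ->
  is_RInt_gen (fun tau => Rpower (tau - t) (- alpha) * f tau) (at_right t) (at_point b)
    (RInt (fun r => f (t + kinv alpha r)) 0 (kern alpha (b - t))).
Proof.
  intros Ha Htb Hf.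
  pose proof (fun r => continuous_shift_kinv f alpha t r Ha Hf) as Hphi.
  set (phi := fun r => f (t + kinv alpha r)) in *.
  (* By the chain rule and [kinv_kern], [Th] is a primitive of the singular integrand for T > t, and
     it is continuous at t because [kern] is continuous at 0. *)
  set (Th := fun T => RInt phi 0 (kern alpha (T - t))).
  replace (RInt phi 0 (kern alpha (b - t))) with (Th b - Th t).
  2: { unfold Th. rewrite (kern_neg _ (t - t)); [|lra]. rewrite RInt_point.
       unfold zero; simpl. ring. }
  apply is_RInt_gen_at_right; [exact Htb| | |].
  - intros T HT. unfold Th.
    replace (Rpower (T - t) (- alpha) * f T) with
      (scal 1 (Rpower (T - t) (- alpha) * phi (kern alpha (T - t)))).
    + apply (is_derive_comp (fun s => RInt phi 0 (kern alpha s)) (fun T => T - t)).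
      * apply is_derive_RInt_kern; [exact Ha|lra|exact Hphi].
      * auto_derive; [exact I|ring].
    + unfold phi. rewrite kinv_kern; [|exact Ha|lra].
      unfold scal; simpl; unfold mult; simpl. replace (t + (T - t)) with T by ring. ring.
  - intros T HT. apply (continuous_mult (K := R_AbsRing)); [|apply Hf].
    apply (continuous_comp (fun T => T - t) (fun u => Rpower u (- alpha))).
    + apply (is_derive_continuous _ _ 1). auto_derive; [exact I|ring].
    + apply Rpower_continuous. lra.
  - unfold Th. apply (continuous_comp (fun T => T - t) (fun s => RInt phi 0 (kern alpha s))).
    + apply (is_derive_continuous _ _ 1). auto_derive; [exact I|ring].
    + now apply continuous_RInt_kern.
Qed.

(** Mirror image of the previous substitution. Existence is what linearity of the Caputo derivative
    requires, as [RInt_gen] is a total function whose value means nothing without convergence. *)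
Lemma ex_RInt_gen_sing_right (f : R -> R) alpha a t : alpha < 1 -> a < t ->
  (forall s, continuous f s) ->
  ex_RInt_gen (fun tau => Rpower (t - tau) (- alpha) * f tau) (at_point a) (at_left t).
Proof.
  intros Ha Hat Hf.
  assert (Hphi : forall r, continuous (fun r => f (t - kinv alpha r)) r).
  { intros r. apply (continuous_comp (fun r => t - kinv alpha r) f); [|apply Hf].
    apply (continuous_minus (fun _ => t) (kinv alpha)); [apply continuous_const|].
    now apply kinv_continuous. }
  set (phi := fun r => f (t - kinv alpha r)) in *.
  set (Th := fun T => - RInt phi 0 (kern alpha (t - T))).
  exists (Th t - Th a).
  apply is_RInt_gen_at_left; [exact Hat| | |].
  - intros T HT. unfold Th.
    replace (Rpower (t - T) (- alpha) * f T) with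
      (- (scal (-1) (Rpower (t - T) (- alpha) * phi (kern alpha (t - T))))).
    + apply (is_derive_opp (fun T => RInt phi 0 (kern alpha (t - T)))).
      apply (is_derive_comp (fun s => RInt phi 0 (kern alpha s)) (fun T => t - T)).
      * apply is_derive_RInt_kern; [exact Ha|lra|exact Hphi].
      * auto_derive; [exact I|ring].
    + unfold phi. rewrite kinv_kern; [|exact Ha|lra].
      unfold scal; simpl; unfold mult; simpl. replace (t - (t - T)) with T by ring. ring.
  - intros T HT. apply (continuous_mult (K := R_AbsRing)); [|apply Hf].
    apply (continuous_comp (fun T => t - T) (fun u => Rpower u (- alpha))).
    + apply (is_derive_continuous _ _ (-1)). auto_derive; [exact I|ring].
    + apply Rpower_continuous. lra.
  - unfold Th. apply (continuous_opp (fun T => RInt phi 0 (kern alpha (t - T)))).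
    apply (continuous_comp (fun T => t - T) (fun s => RInt phi 0 (kern alpha s))).
    + apply (is_derive_continuous _ _ (-1)). auto_derive; [exact I|ring].
    + now apply continuous_RInt_kern.
Qed.

(** * Positivity of Gamma *)

(** For nonnegative g the map T -> [RInt g a T] is increasing, so it converges to the supremum of
    its bounded range. *)
Lemma is_RInt_gen_p_infty_bounded (g : R -> R) a M :
  (forall t, a <= t -> continuous g t) -> (forall t, a <= t -> 0 <= g t) ->
  (forall T, a <= T -> RInt g a T <= M) ->
  exists l, 0 <= l /\ is_RInt_gen g (at_point a) (Rbar_locally p_infty) l.
Proof.
  intros Hc Hp HM.
  assert (Hex : forall u v, a <= u <= v -> ex_RInt g u v).
  { intros u v Huv. apply (ex_RInt_continuous (V := R_CompleteNormedModule)).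
    intros z Hz. apply Hc. rewrite Rmin_left in Hz; lra. }
  assert (Hmono : forall u v, a <= u <= v -> RInt g a u <= RInt g a v).
  { intros u v Huv.
    rewrite -(RInt_Chasles (V := R_CompleteNormedModule) g a u v); [|apply Hex; lra|apply Hex; lra].
    unfold plus; simpl.
    assert (0 <= RInt g u v); [|lra].
    apply RInt_ge_0; [lra|apply Hex; lra|]. intros t Ht; apply Hp; lra. }
  destruct (completeness (fun y => exists T, a <= T /\ y = RInt g a T)) as [l [Hub Hlub]].
  - exists M. intros y [T [HT ->]]. now apply HM.
  - exists (RInt g a a), a. split; [lra|reflexivity].
  - exists l. split.
    { apply Hub. exists a. split; [lra|]. rewrite RInt_point. reflexivity. }
    apply filterlimi_locally. intros [e He].
    assert (exists T0, a <= T0 /\ l - e < RInt g a T0) as [T0 [HT0 HT0e]].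
    { apply NNPP. intros N. assert (l <= l - e); [|lra].
      apply Hlub. intros y [T [HT ->]].
      destruct (Rle_dec (RInt g a T) (l - e)) as [L|L]; [exact L|].
      exfalso. apply N. exists T. split; [exact HT|lra]. }
    apply (Filter_prod _ _ _ (fun x => x = a) (fun T => T0 < T)).
    + reflexivity.
    + exists T0. intros x Hx; exact Hx.
    + intros x T -> HT. exists (RInt g a T). split.
      * apply (RInt_correct (V := R_CompleteNormedModule)). apply Hex; simpl; lra.
      * unfold ball; simpl. unfold AbsRing_ball, abs, minus, plus, opp; simpl.
        assert (RInt g a T <= l) by (apply Hub; exists T; split; [lra|reflexivity]).
        assert (RInt g a T0 <= RInt g a T) by (apply Hmono; lra).
        rewrite Rabs_left1; lra.
Qed.

(** The sign can be read off only once the improper integral is known to converge. Split at 1: on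
    (0,1] the substitution gives a proper integral of a positive continuous function; on [1,
    infinity) the factor t^(-alpha) is at most 1, and what is left, e^(-t), has mass at most 1. *)
Lemma Gamma_pos alpha : 0 < alpha < 1 -> 0 < Gamma (1 - alpha).
Proof.
  intros Ha.
  assert (Hexp : forall t, continuous (fun t => exp (- t)) t).
  { intros t. apply (is_derive_continuous _ _ (- exp (- t))). auto_derive; [exact I|ring]. }
  set (g := fun t => Rpower t (1 - alpha - 1) * exp (- t)).
  assert (Hg : forall t, 0 < t -> continuous g t).
  { intros t Ht. apply (continuous_mult (K := R_AbsRing)); [|apply Hexp].
    now apply Rpower_continuous. }
  assert (Hgpos : forall t, 0 < g t).
  { intros t. apply Rmult_lt_0_compat; apply exp_pos. }
  pose proof (is_RInt_gen_sing_left (fun t => exp (- t)) alpha 0 1 (proj2 Ha) Rlt_0_1 Hexp) as H1.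
  destruct (is_RInt_gen_p_infty_bounded g 1 1) as [l [Hl H2]].
  - intros t Ht. apply Hg; lra.
  - intros t _. left; apply Hgpos.
  - intros T HT. apply (Rle_trans _ (RInt (fun t => exp (- t)) 1 T)).
    + apply RInt_le; [exact HT| | |].
      * apply (ex_RInt_continuous (V := R_CompleteNormedModule)).
        intros z Hz. apply Hg. rewrite Rmin_left in Hz; lra.
      * now apply ex_RInt_cont.
      * intros x Hx. unfold g. rewrite -{2}(Rmult_1_l (exp (- x))).
        apply Rmult_le_compat_r; [left; apply exp_pos|].
        apply (Rle_trans _ (Rpower x 0)); [apply Rle_Rpower; lra|].
        rewrite Rpower_O; lra.
    + rewrite (RInt_of_derive (fun t => - exp (- t)) (fun t => exp (- t))).
      * pose proof (exp_pos (- T)). pose proof (exp_increasing (- (1)) 0) as K. rewrite exp_0 in K.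
        generalize dependent (exp (- (1))). generalize dependent (exp (- T)). intros. lra.
      * intros t _. auto_derive; [exact I|ring].
      * intros t _. apply Hexp.
  - unfold Gamma.
    rewrite (is_RInt_gen_unique (V := R_CompleteNormedModule) _ _
      (is_RInt_gen_Chasles (V := R_NormedModule) g 1 _ _ (is_RInt_gen_ext (V := R_NormedModule) _ g _ _ H1) H2)).
    + unfold plus; simpl. apply Rplus_lt_le_0_compat; [|exact Hl].
      apply RInt_gt_0.
      * apply kern_pos; lra.
      * intros; apply exp_pos.
      * intros x _. apply (continuous_shift_kinv (fun t => exp (- t))); [lra|exact Hexp].
    + apply filter_forall. intros ab x _. unfold g.
      replace (x - 0) with x by ring. now replace (1 - alpha - 1) with (- alpha) by ring.
Qed.

(** * Integrals depending on a parameter *)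

Lemma continuity_2d_pt_eps (f : R -> R -> R) x y :
  continuity_2d_pt f x y -> forall eps, 0 < eps -> exists delta, 0 < delta /\
    forall u v, Rabs (u - x) < delta -> Rabs (v - y) < delta -> Rabs (f u v - f x y) < eps.
Proof.
  intros H eps He. destruct (H (mkposreal eps He)) as [d Hd].
  exists d; split; [apply cond_pos|exact Hd].
Qed.

Lemma continuity_2d_pt_snd (f : R -> R -> R) x y :
  continuity_2d_pt f x y -> continuous (f x) y.
Proof.
  intros H. apply continuous_eps. intros eps He.
  destruct (continuity_2d_pt_eps f x y H eps He) as [d [Hd K]].
  exists d; split; [exact Hd|]. intros v Hv. apply K; [|exact Hv].
  now rewrite Rminus_diag Rabs_R0.
Qed.

Lemma continuity_2d_pt_fst (f : R -> R -> R) x y :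
  continuity_2d_pt f x y -> continuous (fun u => f u y) x.
Proof.
  intros H. apply continuous_eps. intros eps He.
  destruct (continuity_2d_pt_eps f x y H eps He) as [d [Hd K]].
  exists d; split; [exact Hd|]. intros v Hv. apply K; [exact Hv|].
  now rewrite Rminus_diag Rabs_R0.
Qed.

Lemma continuous_RInt_param_le (f : R -> R -> R) c d x : c <= d ->
  (forall u v, continuity_2d_pt f u v) -> continuous (fun u => RInt (f u) c d) x.
Proof.
  intros Hcd Hf. apply continuous_eps. intros eps He.
  (* The extra 1 covers c = d and makes the final estimate strict. *)
  assert (He' : 0 < eps / (d - c + 1)) by (apply Rdiv_lt_0_compat; lra).
  destruct (uniform_continuity_2d f (x - 1) (x + 1) c d (fun u v _ _ => Hf u v)
    (mkposreal _ He')) as [[del Hdel] Hu]. simpl in Hu.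
  exists (Rmin del 1). split; [apply Rmin_pos; lra|]. intros y Hy.
  pose proof (Rlt_le_trans _ _ _ Hy (Rmin_l _ _)) as Hy1.
  pose proof (Rlt_le_trans _ _ _ Hy (Rmin_r _ _)) as Hy2. apply Rabs_def2 in Hy2.
  assert (Hex : forall u, ex_RInt (f u) c d).
  { intros u. apply ex_RInt_cont. intros t. now apply continuity_2d_pt_snd. }
  pose proof (RInt_minus (V := R_CompleteNormedModule) (f y) (f x) c d (Hex y) (Hex x)) as E.
  unfold minus, plus, opp in E; simpl in E. unfold Rminus at 1. rewrite -E.
  eapply Rle_lt_trans.
  - apply (abs_RInt_le_const _ c d (eps / (d - c + 1))); [exact Hcd| |].
    + apply (ex_RInt_minus (V := R_NormedModule) (f y) (f x)); apply Hex.
    + intros t Ht. left. apply (Hu x t y t); try lra.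
      rewrite Rminus_diag Rabs_R0. exact Hdel.
  - apply (Rlt_le_trans _ ((d - c + 1) * (eps / (d - c + 1)))).
    + apply Rmult_lt_compat_r; lra.
    + right. field. lra.
Qed.

Lemma continuous_RInt_param (f : R -> R -> R) c d x :
  (forall u v, continuity_2d_pt f u v) -> continuous (fun u => RInt (f u) c d) x.
Proof.
  intros Hf. destruct (Rle_dec c d) as [L|L]; [now apply continuous_RInt_param_le|].
  apply (continuous_ext (fun u => - RInt (f u) d c)).
  - intros u. exact (opp_RInt_swap (V := R_CompleteNormedModule) (f u) d c
      (ex_RInt_cont (f u) d c (fun t => continuity_2d_pt_snd f u t (Hf u t)))).
  - apply (continuous_opp (fun u => RInt (f u) d c)). apply continuous_RInt_param_le; [lra|exact Hf].
Qed.

Lemma continuity_2d_pt_swap (f : R -> R -> R) x y :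
  continuity_2d_pt f x y -> continuity_2d_pt (fun u v => f v u) y x.
Proof.
  intros H eps. destruct (H eps) as [d Hd]. exists d. intros u v Hu Hv. now apply Hd.
Qed.

(** With b replaced by a variable upper limit T, both iterated integrals vanish at T = a and have
    the same derivative, the integral of [f T] over [c,d]. *)
Lemma Fubini_continuous (f : R -> R -> R) a b c d : a <= b ->
  (forall u v, continuity_2d_pt f u v) ->
  RInt (fun x => RInt (fun y => f x y) c d) a b = RInt (fun y => RInt (fun x => f x y) a b) c d.
Proof.
  intros Hab Hf.
  set (F := fun T y => RInt (fun x => f x y) a T).
  set (A := fun T => RInt (fun x => RInt (fun y => f x y) c d) a T).
  set (B := fun T => RInt (fun y => F T y) c d).
  assert (HF : forall T y, is_derive (fun T => F T y) T (f T y)).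
  { intros T y. apply (is_derive_prim (fun x => f x y)).
    intros s. now apply continuity_2d_pt_fst. }
  assert (HA : forall T, is_derive A T (RInt (fun y => f T y) c d)).
  { intros T. apply (is_derive_prim (fun x => RInt (fun y => f x y) c d)).
    intros s. now apply continuous_RInt_param. }
  assert (ED : forall u v, Derive (fun z => F z v) u = f u v).
  { intros u v. apply is_derive_unique, HF. }
  assert (HB : forall T, is_derive B T (RInt (fun y => f T y) c d)).
  { intros T. unfold B.
    rewrite (RInt_ext (V := R_CompleteNormedModule) _ (fun y => Derive (fun z => F z y) T)).
    2: { intros; now rewrite ED. }
    apply (is_derive_RInt_param F).
    - apply filter_forall. intros u t _. exists (f u t). apply HF.
    - intros t _. apply (continuity_2d_pt_ext f); [|apply Hf]. intros; now rewrite ED.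
    - apply filter_forall. intros u. apply ex_RInt_cont. intros t.
      apply (continuous_RInt_param (fun v x => f x v)).
      intros; now apply continuity_2d_pt_swap. }
  assert (K : A b - B b = A a - B a).
  { apply (deriv_zero_const (fun T => A T - B T) a b Hab).
    - intros t _. replace 0 with (RInt (fun y => f t y) c d - RInt (fun y => f t y) c d) by ring.
      apply (is_derive_minus A B); [apply HA|apply HB].
    - intros t _. apply (continuous_minus A B).
      + exact (is_derive_continuous _ _ _ (HA t)).
      + exact (is_derive_continuous _ _ _ (HB t)). }
  assert (EA : A a = 0) by apply (RInt_point (V := R_CompleteNormedModule)).
  assert (EB : B a = 0).
  { unfold B, F. rewrite (RInt_ext (V := R_CompleteNormedModule) _ (fun _ => 0)).
    - rewrite RInt_const. unfold scal; simpl; unfold mult; simpl; ring.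
    - intros y _. apply (RInt_point (V := R_CompleteNormedModule)). }
  unfold B, A, F in *. lra.
Qed.

(** * Test functions and their Caputo derivatives *)

(** At the junction 0 the factorisation [powp beta y = powp (beta - 1) y * y] reduces
    differentiability to continuity of [powp (beta - 1)], which is where 1 < beta enters. *)
Lemma powp_derive_everywhere beta s : 1 < beta -> is_derive (powp beta) s (beta * powp (beta - 1) s).
Proof.
  intros Hb. destruct (Rtotal_order s 0) as [H|[H|H]].
  - rewrite (powp_neg (beta - 1)); [|lra]. rewrite Rmult_0_r.
    apply (is_derive_ext_loc (fun _ => 0)); [|apply @is_derive_const].
    exists (mkposreal (- s) (Ropp_0_gt_lt_contravar _ H)). intros y Hy. symmetry. apply powp_neg.
    apply Rabs_def2 in Hy. unfold minus, plus, opp in Hy; simpl in Hy. lra.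
  - subst s. rewrite (powp_neg (beta - 1)); [|lra]. apply is_derive_eps. intros eps He.
    destruct (proj1 (continuous_eps _ _) (powp_continuous (beta - 1) 0 ltac:(lra)) eps He)
      as [d [Hd K]].
    exists d; split; [exact Hd|]. intros y Hy.
    rewrite (powp_neg beta 0); [|lra].
    replace (powp beta y - 0 - beta * 0 * (y - 0)) with (powp beta y) by ring.
    specialize (K y Hy). rewrite (powp_neg (beta - 1) 0) in K; [|lra].
    rewrite Rminus_0_r in K. rewrite Rminus_0_r.
    replace (powp beta y) with (powp (beta - 1) y * y).
    + rewrite Rabs_mult. apply Rmult_le_compat_r; [apply Rabs_pos|lra].
    + destruct (Rle_dec y 0) as [L|L]; [rewrite !powp_neg; lra|].
      rewrite !powp_pos; [|lra|lra]. rewrite -{2}(Rpower_1 y); [|lra].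
      rewrite -Rpower_plus. f_equal. ring.
  - rewrite (powp_pos (beta - 1)); [|exact H]. now apply powp_derive.
Qed.

(** A product of truncated powers: differentiation stays within the family, lowering one exponent at
    a time, and the vanishing outside (c,d) is built in. The two exponents are separate because each
    term of a derivative lowers only one of them. *)
Definition bump (c d m n t : R) : R := powp m (t - c) * powp n (d - t).

Lemma bump_outside c d m n t : t <= c \/ d <= t -> bump c d m n t = 0.
Proof.
  intros [H|H]; unfold bump.
  - rewrite (powp_neg m); [ring|lra].
  - rewrite (powp_neg n); [ring|lra].
Qed.

Lemma bump_pos c d m n t : c < t < d -> 0 < bump c d m n t.
Proof.
  intros H. unfold bump. rewrite !powp_pos; [|lra|lra].
  apply Rmult_lt_0_compat; apply exp_pos.
Qed.

Lemma bump_continuous c d m n t : 0 < m -> 0 < n -> continuous (bump c d m n) t.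
Proof.
  intros Hm Hn. apply (continuous_mult (K := R_AbsRing)).
  - apply (continuous_comp (fun t => t - c) (powp m)); [|now apply powp_continuous].
    apply (is_derive_continuous _ _ 1). auto_derive; [exact I|ring].
  - apply (continuous_comp (fun t => d - t) (powp n)); [|now apply powp_continuous].
    apply (is_derive_continuous _ _ (-1)). auto_derive; [exact I|ring].
Qed.

Lemma bump_derive c d m n t : 1 < m -> 1 < n ->
  is_derive (bump c d m n) t (m * bump c d (m - 1) n t - n * bump c d m (n - 1) t).
Proof.
  intros Hm Hn. unfold bump.
  pose proof (powp_derive_everywhere m (t - c) Hm) as Dm.
  pose proof (powp_derive_everywhere n (d - t) Hn) as Dn.
  auto_derive.
  - split; [now eexists; apply Dm|]. split; [now eexists; apply Dn|exact I].
  - rewrite (is_derive_unique (fun x => powp m x) _ _ Dm)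
      (is_derive_unique (fun x => powp n x) _ _ Dn). unfold Rminus; ring.
Qed.

Lemma exists_C3_bump c d : exists h h1 h2 h3 : R -> R,
  (forall t, is_derive h t (h1 t)) /\ (forall t, is_derive h1 t (h2 t)) /\
  (forall t, is_derive h2 t (h3 t)) /\ (forall t, continuous h3 t) /\
  (forall t, c < t < d -> 0 < h t) /\
  (forall t, t <= c \/ d <= t -> h t = 0 /\ h1 t = 0 /\ h2 t = 0 /\ h3 t = 0).
Proof.
  assert (E : forall m n t, 1 < m -> 1 < n -> ex_derive (bump c d m n) t).
  { intros m n t Hm Hn. eexists. now apply bump_derive. }
  assert (ED : forall m n t, 1 < m -> 1 < n -> Derive (bump c d m n) t =
    m * bump c d (m - 1) n t - n * bump c d m (n - 1) t).
  { intros m n t Hm Hn. apply is_derive_unique. now apply bump_derive. }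
  set (D := fun m n t => m * bump c d (m - 1) n t - n * bump c d m (n - 1) t).
  (* The third derivative contains exponents as low as m - 3 and n - 3, which must stay positive for
     continuity. The values are hidden so that terms keep the shape m - 1, m - 1 - 1. *)
  assert (exists m n, 3 < m /\ 3 < n) as [m [n [Hm Hn]]] by (exists 4, 4; lra).
  exists (bump c d m n), (D m n),
    (fun t => m * D (m - 1) n t - n * D m (n - 1) t),
    (fun t => m * ((m - 1) * D (m - 1 - 1) n t - n * D (m - 1) (n - 1) t)
            - n * (m * D (m - 1) (n - 1) t - (n - 1) * D m (n - 1 - 1) t)).
  repeat match goal with |- _ /\ _ => split end.
  - intros t. apply bump_derive; lra.
  - intros t. unfold D at 1. auto_derive.
    + repeat match goal with |- _ /\ _ => split end; try exact I; apply E; lra.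
    + rewrite (ED (m - 1) n t); [|lra|lra]. rewrite (ED m (n - 1) t); [|lra|lra]. unfold D; ring.
  - intros t. unfold D at 1 2. auto_derive.
    + repeat match goal with |- _ /\ _ => split end; try exact I; apply E; lra.
    + rewrite (ED (m - 1 - 1) n t); [|lra|lra]. rewrite (ED m (n - 1 - 1) t); [|lra|lra].
      rewrite (ED (m - 1) (n - 1) t); [|lra|lra]. unfold D; ring.
  - intros t.
    assert (C : forall p q (f g : R -> R), continuous f t -> continuous g t ->
      continuous (fun t => p * f t - q * g t) t).
    { intros p q f g Hf Hg. apply (continuous_minus (fun t => p * f t) (fun t => q * g t)).
      - now apply (continuous_mult (K := R_AbsRing) (fun _ => p) f); [apply continuous_const|].
      - now apply (continuous_mult (K := R_AbsRing) (fun _ => q) g); [apply continuous_const|]. }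
    assert (CD : forall k l, 1 < k -> 1 < l -> continuous (D k l) t).
    { intros k l Hk Hl. apply (C k l (bump c d (k - 1) l) (bump c d k (l - 1)));
      apply bump_continuous; lra. }
    apply (C m n (fun t => (m - 1) * D (m - 1 - 1) n t - n * D (m - 1) (n - 1) t)
      (fun t => m * D (m - 1) (n - 1) t - (n - 1) * D m (n - 1 - 1) t)).
    + apply (C (m - 1) n (D (m - 1 - 1) n) (D (m - 1) (n - 1))); apply CD; lra.
    + apply (C m (n - 1) (D (m - 1) (n - 1)) (D m (n - 1 - 1))); apply CD; lra.
  - intros t Ht. now apply bump_pos.
  - intros t Ht. unfold D. rewrite !(bump_outside c d _ _ t Ht). repeat split; ring.
Qed.

(** Integration by parts with the antiderivative - kern(t - tau) of (t - tau)^(-alpha). Both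
    boundary terms vanish: at tau = t because [kern] is 0 at 0, at tau = a because [h1 a = 0]. *)
Lemma int_sing_right_by_parts (h h1 h2 : R -> R) alpha a t : alpha < 1 -> a <= t ->
  (forall s, is_derive h s (h1 s)) -> (forall s, is_derive h1 s (h2 s)) ->
  (forall s, continuous h2 s) -> h1 a = 0 ->
  int_sing_right (fun tau => Rpower (t - tau) (- alpha) * Derive h tau) a t =
  RInt (fun tau => kern alpha (t - tau) * h2 tau) a t.
Proof.
  intros Ha Hat Hh Hh1 Hc2 H1a. unfold int_sing_right. destruct Rlt_dec as [L|L].
  2: { replace t with a by lra. now rewrite RInt_point. }
  assert (Hsub : forall T, continuous (fun T => t - T) T).
  { intros T. apply (is_derive_continuous _ _ (-1)). auto_derive; [exact I|ring]. }
  assert (Hkc : forall T, continuous (fun tau => kern alpha (t - tau)) T).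
  { intros T. apply (continuous_comp (fun T => t - T) (kern alpha)); [apply Hsub|].
    now apply kern_continuous. }
  assert (Hphi : forall T, continuous (fun tau => kern alpha (t - tau) * h2 tau) T).
  { intros T. apply (continuous_mult (K := R_AbsRing)); [apply Hkc|apply Hc2]. }
  pose proof (fun T => is_derive_prim _ a T Hphi) as HI.
  set (I := fun T => RInt (fun tau => kern alpha (t - tau) * h2 tau) a T) in *.
  set (Th := fun T => I T - kern alpha (t - T) * h1 T).
  apply (is_RInt_gen_unique (V := R_CompleteNormedModule)).
  replace (I t) with (Th t - Th a).
  2: { unfold Th. rewrite H1a (kern_neg _ (t - t)); [|lra].
       assert (I a = 0) by apply (RInt_point (V := R_CompleteNormedModule)). unfold I in *. lra. }
  apply (is_RInt_gen_at_left (fun tau => Rpower (t - tau) (- alpha) * Derive h tau) Th a t);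
    [exact L| | |].
  - intros T HT. rewrite (is_derive_unique _ _ _ (Hh T)).
    assert (HD : is_derive (fun T => kern alpha (t - T)) T (- Rpower (t - T) (- alpha))).
    { replace (- Rpower (t - T) (- alpha)) with (scal (-1) (Rpower (t - T) (- alpha))).
      - apply (is_derive_comp (kern alpha) (fun T => t - T)).
        + apply kern_derive; lra.
        + auto_derive; [exact Logic.I|ring].
      - unfold scal; simpl; unfold mult; simpl; ring. }
    replace (Rpower (t - T) (- alpha) * h1 T) with
      ((kern alpha (t - T) * h2 T) -
       (- Rpower (t - T) (- alpha) * h1 T + kern alpha (t - T) * h2 T)) by ring.
    apply (is_derive_minus I (fun T => kern alpha (t - T) * h1 T)); [apply HI|].
    apply (is_derive_mult (fun T => kern alpha (t - T)) h1); [exact HD|apply Hh1|].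
    intros; apply Rmult_comm.
  - intros T HT. apply (continuous_ext (fun T => Rpower (t - T) (- alpha) * h1 T)).
    { intros s. now rewrite (is_derive_unique _ _ _ (Hh s)). }
    apply (continuous_mult (K := R_AbsRing)); [|exact (is_derive_continuous _ _ _ (Hh1 T))].
    apply (continuous_comp (fun T => t - T) (fun u => Rpower u (- alpha))); [apply Hsub|].
    apply Rpower_continuous. lra.
  - apply (continuous_minus (U := R_UniformSpace) (V := R_NormedModule) I
      (fun T => kern alpha (t - T) * h1 T) t).
    + exact (is_derive_continuous _ _ _ (HI t)).
    + apply (continuous_mult (K := R_AbsRing) (fun T => kern alpha (t - T)) h1 t);
      [apply Hkc|exact (is_derive_continuous _ _ _ (Hh1 t))].
Qed.

(** Removes t from the kernel, whose slope at 0 is infinite when alpha > 0, and from the limits of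
    integration, so that t can be differentiated under the integral sign. Raising the upper limit
    from t - a to b - a costs nothing since g vanishes to the left of a. *)
Lemma RInt_kern_shift (g : R -> R) alpha a b t : alpha < 1 -> a <= t <= b ->
  (forall s, continuous g s) -> (forall s, s <= a -> g s = 0) ->
  RInt (fun tau => kern alpha (t - tau) * g tau) a t =
  RInt (fun s => kern alpha s * g (t - s)) 0 (b - a).
Proof.
  intros Ha Ht Hg Hz.
  assert (Hsub : forall T, continuous (fun T => t - T) T).
  { intros T. apply (is_derive_continuous _ _ (-1)). auto_derive; [exact I|ring]. }
  assert (Hphi : forall T, continuous (fun tau => kern alpha (t - tau) * g tau) T).
  { intros T. apply (continuous_mult (K := R_AbsRing)); [|apply Hg].
    apply (continuous_comp (fun T => t - T) (kern alpha)); [apply Hsub|].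
    now apply kern_continuous. }
  assert (Hpsi : forall T, continuous (fun s => kern alpha s * g (t - s)) T).
  { intros T. apply (continuous_mult (K := R_AbsRing)); [now apply kern_continuous|].
    apply (continuous_comp (fun T => t - T) g); [apply Hsub|apply Hg]. }
  rewrite -(RInt_Chasles (V := R_CompleteNormedModule) _ 0 (t - a) (b - a));
    try (now apply ex_RInt_cont).
  rewrite (RInt_ext (V := R_CompleteNormedModule) _ (fun _ => 0) (t - a) (b - a)).
  2: { intros s Hs. rewrite Rmin_left in Hs; [|lra]. rewrite Hz; [apply Rmult_0_r|lra]. }
  rewrite RInt_const. unfold plus, scal; simpl; unfold mult; simpl.
  rewrite Rmult_0_r Rplus_0_r.
  pose proof (RInt_comp_lin (V := R_CompleteNormedModule)
    (fun tau => kern alpha (t - tau) * g tau) (-1) t 0 (t - a) (ex_RInt_cont _ _ _ Hphi)) as E.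
  replace (-1 * 0 + t) with t in E by ring. replace (-1 * (t - a) + t) with a in E by ring.
  pose proof (opp_RInt_swap (V := R_CompleteNormedModule) _ t a (ex_RInt_cont _ t a Hphi)) as E2.
  rewrite -E2 -E -(RInt_opp (V := R_CompleteNormedModule)).
  - apply (RInt_ext (V := R_CompleteNormedModule)). intros s _.
    unfold opp, scal; simpl; unfold mult; simpl.
    replace (t - (-1 * s + t)) with s by ring. replace (-1 * s + t) with (t - s) by ring. ring.
  - apply (ex_RInt_ext (V := R_NormedModule) (fun s => - (kern alpha s * g (t - s)))).
    + intros s _. unfold scal; simpl; unfold mult; simpl.
      replace (t - (-1 * s + t)) with s by ring. replace (-1 * s + t) with (t - s) by ring. ring.
    + apply ex_RInt_cont. intros s. apply (continuous_opp (V := R_NormedModule)). apply Hpsi.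
Qed.

(** After the integration by parts and the shift, the t-derivative falls on [h2] alone; the
    resulting integrand kern(s) h3(t - s) is jointly continuous. This is the reason for three
    derivatives of h. *)
Lemma caputo_C1_on (h h1 h2 h3 : R -> R) alpha a b : alpha < 1 -> a <= b ->
  (forall s, is_derive h s (h1 s)) -> (forall s, is_derive h1 s (h2 s)) ->
  (forall s, is_derive h2 s (h3 s)) -> (forall s, continuous h3 s) ->
  (forall s, s <= a -> h1 s = 0) -> (forall s, s <= a -> h2 s = 0) ->
  C1_on a b (caputo alpha a h).
Proof.
  intros Ha Hab Hh Hh1 Hh2 Hc3 H1z H2z.
  assert (Hc2 : forall s, continuous h2 s).
  { intros s. exact (is_derive_continuous _ _ _ (Hh2 s)). }
  apply (C1_on_ext a b
    (fun t => / Gamma (1 - alpha) * RInt (fun s => kern alpha s * h2 (t - s)) 0 (b - a))).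
  { intros t Ht. unfold caputo. rewrite (int_sing_right_by_parts h h1 h2); try assumption; try lra.
    - rewrite (RInt_kern_shift h2 alpha a b); auto.
    - apply H1z; lra. }
  assert (Hsub : forall t s, is_derive (fun t => t - s) t 1).
  { intros t s. auto_derive; [exact I|ring]. }
  assert (HD : forall t s, is_derive (fun t => kern alpha s * h2 (t - s)) t (kern alpha s * h3 (t - s))).
  { intros t s. apply (is_derive_scal (fun t => h2 (t - s))).
    replace (h3 (t - s)) with (scal 1 (h3 (t - s))).
    - apply (is_derive_comp h2 (fun t => t - s)); [apply Hh2|apply Hsub].
    - unfold scal; simpl; unfold mult; simpl; ring. }
  assert (ED : forall t s, Derive (fun t => kern alpha s * h2 (t - s)) t = kern alpha s * h3 (t - s)).
  { intros t s. apply is_derive_unique, HD. }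
  assert (H2d : forall t s, continuity_2d_pt (fun t s => kern alpha s * h3 (t - s)) t s).
  { intros t s. apply continuity_2d_pt_mult.
    - apply (continuity_1d_2d_pt_comp (kern alpha) (fun _ s => s)).
      + apply continuity_pt_filterlim. now apply kern_continuous.
      + apply continuity_2d_pt_id2.
    - apply (continuity_1d_2d_pt_comp h3 (fun t s => t - s)).
      + apply continuity_pt_filterlim. apply Hc3.
      + apply continuity_2d_pt_minus; [apply continuity_2d_pt_id1|apply continuity_2d_pt_id2]. }
  apply (is_derive_C1_on a b _
    (fun t => / Gamma (1 - alpha) * RInt (fun s => kern alpha s * h3 (t - s)) 0 (b - a))).
  - intros t _. apply (is_derive_scal (fun t => RInt (fun s => kern alpha s * h2 (t - s)) 0 (b - a))).
    rewrite (RInt_ext (V := R_CompleteNormedModule) _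
      (fun s => Derive (fun t => kern alpha s * h2 (t - s)) t)).
    2: { intros; now rewrite ED. }
    apply (is_derive_RInt_param (fun t s => kern alpha s * h2 (t - s))).
    + apply filter_forall. intros u s _. eexists. apply HD.
    + intros s _. apply (continuity_2d_pt_ext (fun t s => kern alpha s * h3 (t - s))); [|apply H2d].
      intros; now rewrite ED.
    + apply filter_forall. intros u. apply ex_RInt_cont. intros s.
      apply (continuous_mult (K := R_AbsRing)); [now apply kern_continuous|].
      apply (continuous_comp (fun s => u - s) h2); [|apply Hc2].
      apply (is_derive_continuous _ _ (-1)). auto_derive; [exact I|ring].
  - intros t _. apply (continuous_mult (K := R_AbsRing)); [apply continuous_const|].
    now apply (continuous_RInt_param (fun t s => kern alpha s * h3 (t - s))).
Qed.

(** * Fractional integration by parts *)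

Lemma int_sing_left_kern (f Q : R -> R) alpha s b : alpha < 1 -> s <= b ->
  (forall t, continuous Q t) -> (forall t, s <= t <= b -> f t = Q t) ->
  int_sing_left (fun tau => Rpower (tau - s) (- alpha) * f tau) s b =
  RInt (fun r => Q (s + kinv alpha r)) 0 (kern alpha (b - s)).
Proof.
  intros Ha Hsb HQ E. unfold int_sing_left. destruct Rlt_dec as [L|L].
  - apply (is_RInt_gen_unique (V := R_CompleteNormedModule)).
    apply (is_RInt_gen_ext (V := R_NormedModule) (fun tau => Rpower (tau - s) (- alpha) * Q tau)).
    2: { now apply is_RInt_gen_sing_left. }
    apply (Filter_prod _ _ _ (fun x => s < x < b) (fun x => x = b)).
    + now apply at_right_interval.
    + reflexivity.
    + intros u v Hu -> x Hx. simpl in Hx. rewrite Rmin_left in Hx; [|lra].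
      rewrite Rmax_right in Hx; [|lra]. rewrite E; [reflexivity|lra].
  (* At s = b the default value 0 of [int_sing_left] agrees with the empty range of the substituted
     integral. *)
  - replace s with b by lra. rewrite (kern_neg _ (b - b)); [|lra].
    symmetry. apply (RInt_point (V := R_CompleteNormedModule)).
Qed.

Lemma continuous_sub_r a t : continuous (fun T : R => T - a) t.
Proof. apply (is_derive_continuous _ _ 1). auto_derive; [exact I|ring]. Qed.

(** Integration by parts moving the derivative from Q onto the kernel: [Q b = 0] removes the term at
    b, [kern] vanishing at 0 the one at tau, and the singular integral that remains is written in
    substituted form. The proof checks that the defect, as a function of the upper limit T, has zero
    derivative on (tau, b). *)
Lemma RInt_kern_by_parts (Q q : R -> R) alpha tau b : alpha < 1 -> tau <= b ->
  (forall t, is_derive Q t (q t)) -> (forall t, continuous q t) -> Q b = 0 ->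
  RInt (fun t => kern alpha (t - tau) * q t) tau b =
  - RInt (fun r => Q (tau + kinv alpha r)) 0 (kern alpha (b - tau)).
Proof.
  intros Ha Htb HQ Hq Qb.
  assert (HQc : forall t, continuous Q t).
  { intros t. exact (is_derive_continuous _ _ _ (HQ t)). }
  assert (Hkc : forall T, continuous (fun t => kern alpha (t - tau)) T).
  { intros T. apply (continuous_comp (fun T => T - tau) (kern alpha)); [apply continuous_sub_r|].
    now apply kern_continuous. }
  assert (Hphi : forall T, continuous (fun t => kern alpha (t - tau) * q t) T).
  { intros T. apply (continuous_mult (K := R_AbsRing)); [apply Hkc|apply Hq]. }
  pose proof (fun r => continuous_shift_kinv Q alpha tau r Ha HQc) as Hpsi.
  set (psi := fun r => Q (tau + kinv alpha r)) in *.
  set (phi := fun t => kern alpha (t - tau) * q t) in *.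
  assert (K : RInt phi tau b - kern alpha (b - tau) * Q b + RInt psi 0 (kern alpha (b - tau)) =
              RInt phi tau tau - kern alpha (tau - tau) * Q tau + RInt psi 0 (kern alpha (tau - tau))).
  { apply (deriv_zero_const (fun T => RInt phi tau T - kern alpha (T - tau) * Q T
      + RInt psi 0 (kern alpha (T - tau))) tau b Htb).
    - intros T HT.
      assert (HD : is_derive (fun T => kern alpha (T - tau)) T (Rpower (T - tau) (- alpha))).
      { replace (Rpower (T - tau) (- alpha)) with (scal 1 (Rpower (T - tau) (- alpha))).
        - apply (is_derive_comp (kern alpha) (fun T => T - tau)).
          + apply kern_derive; lra.
          + auto_derive; [exact I|ring].
        - unfold scal; simpl; unfold mult; simpl; ring. }
      assert (HD2 : is_derive (fun T => RInt psi 0 (kern alpha (T - tau))) T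
        (Rpower (T - tau) (- alpha) * Q T)).
      { replace (Rpower (T - tau) (- alpha) * Q T) with
          (scal (Rpower (T - tau) (- alpha)) (psi (kern alpha (T - tau)))).
        - apply (is_derive_comp (fun x => RInt psi 0 x) (fun T => kern alpha (T - tau)));
          [now apply is_derive_prim|exact HD].
        - unfold psi. rewrite kinv_kern; [|exact Ha|lra].
          replace (tau + (T - tau)) with T by ring. reflexivity. }
      apply (is_derive_eq _ _ ((phi T - (Rpower (T - tau) (- alpha) * Q T + kern alpha (T - tau) * q T))
        + Rpower (T - tau) (- alpha) * Q T)); [unfold phi; ring|].
      apply (is_derive_plus (K := R_AbsRing) (V := R_NormedModule)
        (fun T => RInt phi tau T - kern alpha (T - tau) * Q T)
        (fun T => RInt psi 0 (kern alpha (T - tau)))); [|exact HD2].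
      apply (is_derive_minus (K := R_AbsRing) (V := R_NormedModule)
        (fun T => RInt phi tau T) (fun T => kern alpha (T - tau) * Q T));
        [now apply is_derive_prim|].
      apply (is_derive_mult (fun T => kern alpha (T - tau)) Q); [exact HD|apply HQ|].
      intros; apply Rmult_comm.
    - intros T _.
      apply (continuous_plus (U := R_UniformSpace) (V := R_NormedModule)
        (fun T => RInt phi tau T - kern alpha (T - tau) * Q T)
        (fun T => RInt psi 0 (kern alpha (T - tau))) T).
      + apply (continuous_minus (U := R_UniformSpace) (V := R_NormedModule)
          (fun T => RInt phi tau T) (fun T => kern alpha (T - tau) * Q T) T).
        * exact (is_derive_continuous _ _ _ (is_derive_prim phi tau T Hphi)).
        * apply (continuous_mult (K := R_AbsRing) (fun T => kern alpha (T - tau)) Q T); auto.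
      + apply (continuous_comp (fun T => T - tau) (fun s => RInt psi 0 (kern alpha s)));
          [apply continuous_sub_r|now apply continuous_RInt_kern]. }
  rewrite (kern_neg _ (tau - tau)) in K; [|lra]. rewrite !RInt_point Qb in K.
  unfold zero in K; simpl in K. lra.
Qed.

(** Leibniz rule: in substituted form tau occurs in Q and in the upper limit, and the moving limit
    contributes a multiple of [Q b], that is 0. Strictness of tau < b is needed to differentiate
    [kern] at b - tau. *)
Lemma is_derive_RInt_shift_kinv (Q q : R -> R) alpha tau b : alpha < 1 -> tau < b ->
  (forall t, is_derive Q t (q t)) -> (forall t, continuous q t) -> Q b = 0 ->
  is_derive (fun tau => RInt (fun r => Q (tau + kinv alpha r)) 0 (kern alpha (b - tau))) tau
    (RInt (fun r => q (tau + kinv alpha r)) 0 (kern alpha (b - tau))).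
Proof.
  intros Ha Htb HQ Hq Qb.
  assert (HQc : forall t, continuous Q t).
  { intros t. exact (is_derive_continuous _ _ _ (HQ t)). }
  assert (HD : forall u r, is_derive (fun u => Q (u + kinv alpha r)) u (q (u + kinv alpha r))).
  { intros u r. replace (q (u + kinv alpha r)) with (scal 1 (q (u + kinv alpha r))).
    - apply (is_derive_comp Q (fun u => u + kinv alpha r)); [apply HQ|].
      auto_derive; [exact I|ring].
    - unfold scal; simpl; unfold mult; simpl; ring. }
  assert (ED : forall u r, Derive (fun u => Q (u + kinv alpha r)) u = q (u + kinv alpha r)).
  { intros u r. apply is_derive_unique, HD. }
  assert (Hex : forall u v w, ex_RInt (fun r => Q (u + kinv alpha r)) v w).
  { intros u v w. apply ex_RInt_cont. intros r. now apply continuous_shift_kinv. }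
  assert (H2d : forall u r, continuity_2d_pt
    (fun u r => Derive (fun u => Q (u + kinv alpha r)) u) u r).
  { intros u r. apply (continuity_2d_pt_ext (fun u r => q (u + kinv alpha r))).
    { intros; now rewrite ED. }
    apply (continuity_1d_2d_pt_comp q (fun u r => u + kinv alpha r)).
    - apply continuity_pt_filterlim. apply Hq.
    - apply continuity_2d_pt_plus; [apply continuity_2d_pt_id1|].
      apply (continuity_1d_2d_pt_comp (kinv alpha) (fun _ r => r)).
      + apply continuity_pt_filterlim. now apply kinv_continuous.
      + apply continuity_2d_pt_id2. }
  replace (RInt (fun r => q (tau + kinv alpha r)) 0 (kern alpha (b - tau))) with
    (RInt (fun r => Derive (fun u => Q (u + kinv alpha r)) tau) 0 (kern alpha (b - tau))
     + Q (tau + kinv alpha (kern alpha (b - tau))) * (- Rpower (b - tau) (- alpha))).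
  2: { rewrite kinv_kern; [|exact Ha|lra]. replace (tau + (b - tau)) with b by ring.
       rewrite Qb Rmult_0_l Rplus_0_r. apply (RInt_ext (V := R_CompleteNormedModule)).
       intros; apply ED. }
  apply (is_derive_RInt_param_bound_comp_aux3 (fun u r => Q (u + kinv alpha r)) 0
    (fun tau => kern alpha (b - tau))).
  - apply filter_forall. intros; apply Hex.
  - exists (mkposreal 1 Rlt_0_1). apply filter_forall. intros; apply Hex.
  - replace (- Rpower (b - tau) (- alpha)) with (scal (-1) (Rpower (b - tau) (- alpha))).
    + apply (is_derive_comp (kern alpha) (fun u => b - u)); [apply kern_derive; lra|].
      auto_derive; [exact I|ring].
    + unfold scal; simpl; unfold mult; simpl; ring.
  - exists (mkposreal 1 Rlt_0_1). apply filter_forall. intros u r _. eexists. apply HD.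
  - intros r _. apply H2d.
  - exists (mkposreal 1 Rlt_0_1). intros u r _ _. apply H2d.
  - apply continuity_pt_filterlim. now apply continuous_shift_kinv.
Qed.

Lemma RInt_support (f : R -> R) a b c d : a <= c <= d -> d <= b ->
  (forall t, t <= c \/ d <= t -> f t = 0) -> ex_RInt f c d ->
  RInt f a b = RInt f c d.
Proof.
  intros Hac Hdb Hz Hex.
  assert (Z : forall u v, u <= v -> v <= c \/ d <= u -> is_RInt f u v 0).
  { intros u v Huv H. apply (is_RInt_ext (V := R_NormedModule) (fun _ => 0)).
    - intros x Hx. rewrite Rmin_left in Hx; [|lra]. rewrite Rmax_right in Hx; [|lra].
      symmetry. apply Hz. lra.
    - pose proof (is_RInt_const (V := R_NormedModule) u v 0) as K.
      rewrite (scal_zero_r (V := R_NormedModule) (v - u)) in K. exact K. }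
  apply is_RInt_unique.
  replace (RInt f c d) with (plus (plus 0 (RInt f c d)) 0).
  - apply (is_RInt_Chasles (V := R_NormedModule) f a d b); [|apply Z; lra].
    apply (is_RInt_Chasles (V := R_NormedModule) f a c d); [apply Z; lra|].
    now apply (RInt_correct (V := R_CompleteNormedModule)).
  - unfold plus; simpl; ring.
Qed.

Lemma RInt_scal_R (f : R -> R) l a b : ex_RInt f a b ->
  RInt (fun t => l * f t) a b = l * RInt f a b.
Proof. intros H. exact (RInt_scal (V := R_CompleteNormedModule) f a b l H). Qed.

(* Fubini moves the kernel onto q; two integrations by parts on [c, d] then convert h'' back
   into h and the iterated integral of q into D. *)
Lemma fractional_integration_by_parts (q D J h h1 h2 h3 : R -> R) alpha a b c d :
  0 < alpha < 1 -> a < c < d -> d < b ->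
  (forall t, continuous q t) -> (forall t, continuous D t) ->
  (forall t, a < t < b -> is_derive J t (- Gamma (1 - alpha) * D t)) ->
  (forall t, a <= t <= b -> J t = RInt (fun r => q (t + kinv alpha r)) 0 (kern alpha (b - t))) ->
  (forall t, is_derive h t (h1 t)) -> (forall t, is_derive h1 t (h2 t)) ->
  (forall t, is_derive h2 t (h3 t)) ->
  (forall t, t <= c \/ d <= t -> h t = 0 /\ h1 t = 0 /\ h2 t = 0 /\ h3 t = 0) ->
  RInt (fun t => q t * caputo alpha a h t) a b = RInt (fun t => D t * h t) a b.
Proof.
  intros Ha Hac Hdb Hq HD HJ EJ Hh Hh1 Hh2 Hz.
  assert (Hc0 : forall t, continuous h t).
  { intros t. exact (is_derive_continuous _ _ _ (Hh t)). }
  assert (Hc1 : forall t, continuous h1 t).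
  { intros t. exact (is_derive_continuous _ _ _ (Hh1 t)). }
  assert (Hc2 : forall t, continuous h2 t).
  { intros t. exact (is_derive_continuous _ _ _ (Hh2 t)). }
  pose proof (Gamma_pos alpha Ha) as HG.
  (* The primitive is normalised at b, as both the integration by parts and the Leibniz rule
     require. *)
  set (Q := fun t => RInt q b t).
  assert (HQ : forall t, is_derive Q t (q t)).
  { intros t. now apply (is_derive_prim q). }
  assert (Qb : Q b = 0) by apply (RInt_point (V := R_CompleteNormedModule)).
  set (G := fun tau => RInt (fun r => Q (tau + kinv alpha r)) 0 (kern alpha (b - tau))).
  assert (Hkc : forall t tau, continuous (fun u => kern alpha (t - u)) tau).
  { intros t tau. apply (continuous_comp (fun u => t - u) (kern alpha)); [|apply kern_continuous; lra].
    apply (is_derive_continuous _ _ (-1)). auto_derive; [exact I|ring]. }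
  assert (Hkc' : forall tau t, continuous (fun u => kern alpha (u - tau)) t).
  { intros tau t. apply (continuous_comp (fun u => u - tau) (kern alpha));
    [apply continuous_sub_r|apply kern_continuous; lra]. }
  assert (H2d : forall t tau, continuity_2d_pt
    (fun t tau => q t * (kern alpha (t - tau) * h2 tau)) t tau).
  { intros t tau. apply continuity_2d_pt_mult; [|apply continuity_2d_pt_mult].
    - apply (continuity_1d_2d_pt_comp q (fun t _ => t)); [|apply continuity_2d_pt_id1].
      apply continuity_pt_filterlim, Hq.
    - apply (continuity_1d_2d_pt_comp (kern alpha) (fun t tau => t - tau)).
      + apply continuity_pt_filterlim, kern_continuous. lra.
      + apply continuity_2d_pt_minus; [apply continuity_2d_pt_id1|apply continuity_2d_pt_id2].
    - apply (continuity_1d_2d_pt_comp h2 (fun _ tau => tau)); [|apply continuity_2d_pt_id2].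
      apply continuity_pt_filterlim, Hc2. }
  (* Since [kern] vanishes on negative arguments, the inner integral over [a,t] extends to [a,b]:
     the triangle becomes a rectangle and Fubini applies. *)
  assert (Hcap : forall t, a < t < b -> q t * caputo alpha a h t =
    / Gamma (1 - alpha) * RInt (fun tau => q t * (kern alpha (t - tau) * h2 tau)) a b).
  { intros t Ht. unfold caputo.
    rewrite (int_sing_right_by_parts h h1 h2); try assumption; try lra; [|apply Hz; lra].
    assert (Hphi : forall tau, continuous (fun tau => kern alpha (t - tau) * h2 tau) tau).
    { intros tau. apply (continuous_mult (K := R_AbsRing) (fun tau => kern alpha (t - tau)) h2); auto. }
    rewrite RInt_scal_R; [|now apply ex_RInt_cont].
    rewrite -(RInt_Chasles (V := R_CompleteNormedModule) _ a t b); try (now apply ex_RInt_cont).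
    rewrite (RInt_ext (V := R_CompleteNormedModule) _ (fun _ => 0) t b).
    - rewrite RInt_const. unfold plus, scal; simpl; unfold mult; simpl. ring.
    - intros tau Htau. rewrite Rmin_left in Htau; [|lra].
      rewrite kern_neg; [apply Rmult_0_l|lra]. }
  rewrite (RInt_ext (V := R_CompleteNormedModule) _ (fun t => / Gamma (1 - alpha) *
    RInt (fun tau => q t * (kern alpha (t - tau) * h2 tau)) a b)).
  2: { intros t Ht. rewrite Rmin_left in Ht; [|lra]. rewrite Rmax_right in Ht; [|lra]. now apply Hcap. }
  rewrite RInt_scal_R.
  2: { apply ex_RInt_cont. intros t.
       now apply (continuous_RInt_param (fun t tau => q t * (kern alpha (t - tau) * h2 tau))). }
  rewrite (Fubini_continuous (fun t tau => q t * (kern alpha (t - tau) * h2 tau))); [|lra|exact H2d].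
  assert (HGd : forall tau, tau < b -> is_derive G tau
    (RInt (fun r => q (tau + kinv alpha r)) 0 (kern alpha (b - tau)))).
  { intros tau Htau. apply is_derive_RInt_shift_kinv; auto; lra. }
  rewrite (RInt_ext (V := R_CompleteNormedModule) _ (fun tau => h2 tau * (- G tau))).
  2: { intros tau Htau. rewrite Rmin_left in Htau; [|lra]. rewrite Rmax_right in Htau; [|lra].
    unfold G. rewrite -(RInt_kern_by_parts Q q); auto; try lra.
    assert (Hphi : forall t, continuous (fun t => kern alpha (t - tau) * q t) t).
    { intros t. apply (continuous_mult (K := R_AbsRing) (fun t => kern alpha (t - tau)) q); auto. }
    rewrite (RInt_ext (V := R_CompleteNormedModule) _ (fun t => h2 tau * (kern alpha (t - tau) * q t))).
    2: { intros t _. simpl. ring. }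
    rewrite RInt_scal_R; [|now apply ex_RInt_cont].
    rewrite -(RInt_Chasles (V := R_CompleteNormedModule) _ a tau b); try (now apply ex_RInt_cont).
    rewrite (RInt_ext (V := R_CompleteNormedModule) _ (fun _ => 0) a tau).
    - rewrite RInt_const. unfold plus, scal; simpl; unfold mult; simpl. ring.
    - intros t Ht. rewrite Rmax_right in Ht; [|lra].
      rewrite kern_neg; [apply Rmult_0_l|lra]. }
  assert (HGc : forall tau, c <= tau <= d -> continuous (fun tau => h2 tau * - G tau) tau).
  { intros tau Htau. apply (continuous_mult (K := R_AbsRing) h2 (fun tau => - G tau) tau); [auto|].
    apply (continuous_opp (U := R_UniformSpace) (V := R_NormedModule) G).
    apply (is_derive_continuous _ _ _ (HGd tau ltac:(lra))). }
  assert (HDh : forall t, continuous (fun t => D t * h t) t).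
  { intros t. apply (continuous_mult (K := R_AbsRing) D h); auto. }
  assert (Hex : ex_RInt (fun tau => h2 tau * - G tau) c d).
  { apply (ex_RInt_continuous (V := R_CompleteNormedModule)). intros z Hzz.
    rewrite Rmin_left in Hzz; [|lra]. rewrite Rmax_right in Hzz; [|lra]. now apply HGc. }
  rewrite (RInt_support (fun tau => h2 tau * - G tau) a b c d); try lra; [|intros t Ht|exact Hex].
  2: { destruct (Hz t Ht) as [_ [_ [-> _]]]. ring. }
  rewrite (RInt_support (fun t => D t * h t) a b c d); try lra; [|intros t Ht|now apply ex_RInt_cont].
  2: { destruct (Hz t Ht) as [-> _]. ring. }
  (* As G' = J and J' = - Gamma(1-alpha) D, differentiating h1 (-G) + h J cancels the two terms h1 J
     and leaves exactly this integrand. The boundary values vanish because h and h1 vanish at c and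
     d. *)
  assert (K : RInt (fun t => h2 t * - G t - Gamma (1 - alpha) * (D t * h t)) c d =
    (h1 d * - G d + h d * J d) - (h1 c * - G c + h c * J c)).
  { apply (RInt_of_derive (fun t => h1 t * - G t + h t * J t)).
    - intros t Ht. rewrite Rmin_left in Ht; [|lra]. rewrite Rmax_right in Ht; [|lra].
      apply (is_derive_eq _ _ ((h2 t * - G t + h1 t * - J t) +
        (h1 t * J t + h t * (- Gamma (1 - alpha) * D t)))); [ring|].
      apply (is_derive_plus (K := R_AbsRing) (V := R_NormedModule) (fun t => h1 t * - G t) (fun t => h t * J t)).
      + apply (is_derive_mult h1 (fun t => - G t)); [apply Hh1| |intros; apply Rmult_comm].
        apply (is_derive_opp (K := R_AbsRing) (V := R_NormedModule) G). rewrite EJ; [|lra].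
        apply HGd. lra.
      + apply (is_derive_mult h J); [apply Hh|apply HJ; lra|intros; apply Rmult_comm].
    - intros t Ht. rewrite Rmin_left in Ht; [|lra]. rewrite Rmax_right in Ht; [|lra].
      apply (continuous_minus (U := R_UniformSpace) (V := R_NormedModule)
        (fun t => h2 t * - G t) (fun t => Gamma (1 - alpha) * (D t * h t)) t); [now apply HGc|].
      apply (continuous_mult (K := R_AbsRing) (fun _ => Gamma (1 - alpha)) (fun t => D t * h t) t);
        [apply continuous_const|apply HDh]. }
  destruct (Hz c (or_introl (Rle_refl c))) as [E1 [E2 _]].
  destruct (Hz d (or_intror (Rle_refl d))) as [E3 [E4 _]].
  rewrite E1 E2 E3 E4 in K.
  pose proof (RInt_minus (V := R_CompleteNormedModule) (fun t => h2 t * - G t)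
    (fun t => Gamma (1 - alpha) * (D t * h t)) c d Hex
    (ex_RInt_scal (V := R_NormedModule) (fun t => D t * h t) c d _ (ex_RInt_cont _ c d HDh))) as K2.
  unfold minus, plus, opp in K2; simpl in K2. unfold Rminus at 1 in K. rewrite K2 in K.
  rewrite RInt_scal_R in K; [|now apply ex_RInt_cont].
  apply (Rmult_eq_reg_l (Gamma (1 - alpha))); [|lra].
  rewrite -Rmult_assoc Rinv_r; [|lra]. lra.
Qed.

(** * A fundamental lemma of the calculus of variations with Caputo derivatives *)

Lemma exists_constant_sign_interval (w : R -> R) a b t0 : a < b -> a <= t0 <= b ->
  continuous w t0 -> w t0 <> 0 ->
  exists c d, a < c < d /\ d < b /\ forall t, c < t < d -> 0 < w t0 * w t.
Proof.
  intros Hab Ht0 Hw Hn.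
  assert (Hp : 0 < Rabs (w t0)) by now apply Rabs_pos_lt.
  destruct (proj1 (continuous_eps w t0) Hw _ Hp) as [e [He K]].
  (* Since t0 may be an endpoint, (c,d) is placed beside t0, on the side where at least half of
     [a,b] lies. *)
  assert (exists c d, a < c < d /\ d < b /\ t0 - e < c /\ d < t0 + e) as [c [d H]].
  { set (m := Rmin e (b - a)).
    assert (0 < m) by (apply Rmin_pos; lra).
    assert (m <= e) by apply Rmin_l. assert (m <= b - a) by apply Rmin_r. clearbody m.
    destruct (Rle_dec t0 ((a + b) / 2)).
    - exists (t0 + m / 8), (t0 + m / 4). lra.
    - exists (t0 - m / 4), (t0 - m / 8). lra. }
  exists c, d. split; [lra|split; [lra|]]. intros t Ht.
  assert (Kt : Rabs (w t - w t0) < Rabs (w t0)).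
  { apply K. apply Rabs_def1; lra. }
  destruct (Rdichotomy _ _ Hn) as [L|L].
  - rewrite (Rabs_left (w t0)) in Kt; [|exact L]. apply Rabs_def2 in Kt. apply Rmult_neg_neg; lra.
  - rewrite (Rabs_right (w t0)) in Kt; [|lra]. apply Rabs_def2 in Kt. apply Rmult_lt_0_compat; lra.
Qed.

(** Both f and q occur because the Riemann-Liouville derivative is given for a function controlled
    on [a,b] only, whereas the integral calculus is carried out with a continuous extension of it to
    R. *)
Lemma fractional_fundamental_lemma (p q f D : R -> R) alpha a b :
  0 < alpha < 1 -> a < b -> (forall t, continuous p t) -> (forall t, continuous q t) ->
  (forall t, a <= t <= b -> f t = q t) -> cont_on a b D -> is_right_RL_deriv alpha a b f D ->
  (forall h, C1_on a b h -> C1_on a b (caputo alpha a h) -> h a = 0 -> h b = 0 ->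
    RInt (fun t => p t * h t + q t * caputo alpha a h t) a b = 0) ->
  forall t, a <= t <= b -> p t + D t = 0.
Proof.
  intros Ha Hab Hp Hq Ef HD HRL Hvar t0 Ht0.
  destruct (cont_on_extend a b D (Rlt_le _ _ Hab) HD) as [E [HE EE]].
  destruct (Req_dec (p t0 + E t0) 0) as [Z|N]; [rewrite EE in Z; assumption|exfalso].
  assert (Hw : forall t, continuous (fun t => p t + E t) t).
  { intros t. apply (continuous_plus (U := R_UniformSpace) (V := R_NormedModule) p E); auto. }
  destruct (exists_constant_sign_interval (fun t => p t + E t) a b t0 Hab Ht0 (Hw t0) N)
    as [c [d [Hac [Hdb Hsign]]]].
  destruct (exists_C3_bump c d) as [h [h1 [h2 [h3 [Hh [Hh1 [Hh2 [Hc3 [Hpos Hz]]]]]]]]].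
  assert (Hc0 : forall t, continuous h t).
  { intros t. exact (is_derive_continuous _ _ _ (Hh t)). }
  assert (HC : C1_on a b (caputo alpha a h)).
  { apply (caputo_C1_on h h1 h2 h3); auto; try lra; intros s Hs; apply Hz; lra. }
  destruct (cont_on_extend a b _ (Rlt_le _ _ Hab) (C1_on_cont a b _ HC)) as [V [HV EV]].
  set (J := fun s => int_sing_left (fun tau => Rpower (tau - s) (- alpha) * f tau) s b).
  pose proof (fractional_integration_by_parts q E J h h1 h2 h3 alpha a b c d Ha Hac Hdb Hq HE) as IBP.
  rewrite (RInt_ext (V := R_CompleteNormedModule) _ (fun t => q t * V t)) in IBP.
  2: { intros t Ht. rewrite Rmin_left in Ht; [|lra]. rewrite Rmax_right in Ht; [|lra].
       now rewrite EV; [|lra]. }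
  assert (H0 : RInt (fun t => p t * h t + q t * V t) a b = 0).
  { rewrite -(Hvar h).
    - apply (RInt_ext (V := R_CompleteNormedModule)). intros t Ht.
      rewrite Rmin_left in Ht; [|lra]. rewrite Rmax_right in Ht; [|lra]. now rewrite EV; [|lra].
    - apply (is_derive_C1_on a b h h1); auto. intros t _.
      exact (is_derive_continuous _ _ _ (Hh1 t)).
    - exact HC.
    - apply Hz; lra.
    - apply Hz; lra. }
  assert (Hph : forall t, continuous (fun t => p t * h t) t).
  { intros t. apply (continuous_mult (K := R_AbsRing) p h); auto. }
  assert (HqV : forall t, continuous (fun t => q t * V t) t).
  { intros t. apply (continuous_mult (K := R_AbsRing) q V); auto. }
  assert (HEh : forall t, continuous (fun t => E t * h t) t).
  { intros t. apply (continuous_mult (K := R_AbsRing) E h); auto. }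
  pose proof (RInt_plus (V := R_CompleteNormedModule) (fun t => p t * h t) (fun t => q t * V t) a b
    (ex_RInt_cont _ _ _ Hph) (ex_RInt_cont _ _ _ HqV)) as E1.
  pose proof (RInt_plus (V := R_CompleteNormedModule) (fun t => p t * h t) (fun t => E t * h t) a b
    (ex_RInt_cont _ _ _ Hph) (ex_RInt_cont _ _ _ HEh)) as E2.
  unfold plus in E1, E2; simpl in E1, E2. rewrite E1 in H0.
  rewrite IBP in H0; auto.
  - rewrite -E2 in H0.
    set (w0 := p t0 + E t0) in *.
    assert (Hwh : forall t, continuous (fun t => (p t + E t) * h t) t).
    { intros t. apply (continuous_mult (K := R_AbsRing) (fun t => p t + E t) h); auto. }
    (* Multiplying by the constant [w0] treats both signs of p + E at t0 at once. *)
    assert (P : 0 < RInt (fun t => w0 * ((p t + E t) * h t)) c d).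
    { apply RInt_gt_0; [lra| |].
      - intros t Ht. rewrite -Rmult_assoc. apply Rmult_lt_0_compat; auto.
      - intros t _. apply (continuous_mult (K := R_AbsRing) (fun _ => w0) (fun t => (p t + E t) * h t));
        [apply continuous_const|apply Hwh]. }
    rewrite RInt_scal_R in P; [|now apply ex_RInt_cont].
    rewrite -(RInt_support (fun t => (p t + E t) * h t) a b) in P; try lra.
    + rewrite (RInt_ext (V := R_CompleteNormedModule) _ (fun t => p t * h t + E t * h t)) in P.
      * rewrite H0 in P. lra.
      * intros t _. simpl. ring.
    + intros t Ht. destruct (Hz t Ht) as [-> _]. ring.
    + now apply ex_RInt_cont.
  - intros t Ht. rewrite EE; [|lra]. apply (within_is_derive a b); [exact Ht|]. apply HRL. lra.
  - intros t Ht. apply int_sing_left_kern; auto; try lra. intros s Hs. apply Ef. lra.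
Qed.

(** * First variation of the solution *)

(** First-crossing argument: let m be the supremum of the times up to which psi stays negative. If
    psi were to reach 0, it would do so at m from below, while a negative derivative at m forces psi
    > 0 just before m. *)
Lemma barrier (psi dpsi : R -> R) a b :
  (forall t, a <= t <= b -> is_derive psi t (dpsi t)) -> psi a < 0 ->
  (forall t, a <= t <= b -> psi t = 0 -> dpsi t < 0) ->
  forall t, a <= t <= b -> psi t < 0.
Proof.
  intros Hd Ha H0 t1 Ht1.
  destruct (Rlt_dec (psi t1) 0) as [L|N]; [exact L|exfalso].
  destruct (completeness (fun s => a <= s <= t1 /\ forall r, a <= r <= s -> psi r < 0))
    as [m [Hub Hlub]].
  - exists t1. intros s [Hs _]. lra.
  - exists a. split; [lra|]. intros r Hr. now replace r with a by lra.
  - assert (Ham : a <= m).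
    { apply Hub. split; [lra|]. intros r Hr. now replace r with a by lra. }
    assert (Hmt : m <= t1) by (apply Hlub; intros s [Hs _]; lra).
    assert (Hbelow : forall r, a <= r < m -> psi r < 0).
    { intros r Hr. apply Rnot_le_lt. intros Hr0. assert (m <= r); [|lra].
      apply Hlub. intros s [Hs Hneg]. apply Rnot_lt_le. intros Hrs.
      specialize (Hneg r ltac:(lra)). lra. }
    assert (Hdm : is_derive psi m (dpsi m)) by (apply Hd; lra).
    destruct (Rtotal_order (psi m) 0) as [L|[Z|G]].
    + destruct (proj1 (continuous_eps psi m) (is_derive_continuous _ _ _ Hdm) (- psi m) ltac:(lra))
        as [e [He K]].
      assert (Hm1 : m <> t1) by (intros ->; lra).
      set (s := Rmin (m + e / 2) t1).
      assert (m < s) by (apply Rmin_glb_lt; lra).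
      assert (s <= m + e / 2) by apply Rmin_l. assert (s <= t1) by apply Rmin_r.
      assert (s <= m); [|lra]. apply Hub. split; [lra|]. intros r Hr.
      destruct (Rlt_dec r m); [apply Hbelow; lra|].
      assert (Kr : Rabs (psi r - psi m) < - psi m) by (apply K; apply Rabs_def1; lra).
      apply Rabs_def2 in Kr. lra.
    + assert (a <> m) by (intros <-; lra).
      pose proof (H0 m ltac:(lra) Z) as Hneg.
      destruct (proj1 (is_derive_eps psi m (dpsi m)) Hdm (- dpsi m / 2) ltac:(lra)) as [e [He K]].
      set (y := Rmax a (m - e / 2)).
      assert (a <= y) by apply Rmax_l. assert (m - e / 2 <= y) by apply Rmax_r.
      assert (y < m) by (apply Rmax_lub_lt; lra).
      pose proof (Hbelow y ltac:(lra)) as Hy.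
      pose proof (K y ltac:(apply Rabs_def1; lra)) as Ky. rewrite Z in Ky.
      rewrite (Rabs_left (y - m)) in Ky; [|lra].
      assert (Kz : dpsi m * (y - m) - psi y <= - dpsi m / 2 * - (y - m)).
      { eapply Rle_trans; [|exact Ky]. rewrite -Rabs_Ropp. eapply Rle_trans; [|apply Rle_abs].
        right; ring. }
      assert (0 < - dpsi m * (m - y)) by (apply Rmult_lt_0_compat; lra). lra.
    + assert (a <> m) by (intros <-; lra).
      destruct (proj1 (continuous_eps psi m) (is_derive_continuous _ _ _ Hdm) (psi m) G)
        as [e [He K]].
      set (y := Rmax a (m - e / 2)).
      assert (a <= y) by apply Rmax_l. assert (m - e / 2 <= y) by apply Rmax_r.
      assert (y < m) by (apply Rmax_lub_lt; lra).
      pose proof (Hbelow y ltac:(lra)) as Hy.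
      assert (Ky : Rabs (psi y - psi m) < psi m) by (apply K; apply Rabs_def1; lra).
      apply Rabs_def2 in Ky. lra.
Qed.

(* The differential inequality is only assumed while |u| < rho: the barrier keeps u there. *)
Lemma local_gronwall (u du : R -> R) a b C K rho : 0 < C -> 0 <= K ->
  (forall t, a <= t <= b -> is_derive u t (du t)) -> u a = 0 ->
  (forall t, a <= t <= b -> Rabs (u t) < rho -> Rabs (du t) <= C + K * Rabs (u t)) ->
  C * exp ((K + 2) * (b - a)) < rho ->
  forall t, a <= t <= b -> Rabs (u t) <= C * exp ((K + 2) * (b - a)).
Proof.
  intros HC HK Hu Hua Hdu Hrho t Ht.
  (* The rate K + 2 makes g a strict supersolution: g >= C > 0 gives (K + 2) g > C + K g, the strict
     sign that [barrier] demands. *)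
  set (g := fun t => C * exp ((K + 2) * (t - a))).
  assert (Hg : forall t, is_derive g t ((K + 2) * g t)).
  { intros s. unfold g. auto_derive; [exact I|unfold Rminus; ring]. }
  assert (Hgb : forall t, t <= b -> g t <= g b).
  { intros s Hs. apply Rmult_le_compat_l; [lra|]. destruct (Req_dec s b) as [->|N]; [lra|].
    left. apply exp_increasing. apply Rmult_lt_compat_l; lra. }
  assert (HgC : forall t, a <= t -> C <= g t).
  { intros s Hs. unfold g. rewrite -{1}(Rmult_1_r C). apply Rmult_le_compat_l; [lra|].
    rewrite -exp_0. destruct (Req_dec s a) as [->|N].
    - right. f_equal. ring.
    - left. apply exp_increasing. apply Rmult_lt_0_compat; lra. }
  (* Squares replace |u| and g because |u| need not be differentiable where u vanishes. *)
  assert (Hpsi : u t * u t - g t * g t < 0).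
  { apply (barrier (fun t => u t * u t - g t * g t)
      (fun t => (du t * u t + u t * du t) -
        ((K + 2) * g t * g t + g t * ((K + 2) * g t))) a b).
    - intros s Hs. apply (is_derive_minus (K := R_AbsRing) (V := R_NormedModule)
        (fun t => u t * u t) (fun t => g t * g t)).
      + apply (is_derive_mult u u); [now apply Hu|now apply Hu|intros; apply Rmult_comm].
      + apply (is_derive_mult g g); [apply Hg|apply Hg|intros; apply Rmult_comm].
    - rewrite Hua. pose proof (HgC a (Rle_refl a)).
      assert (0 < g a * g a) by (apply Rmult_lt_0_compat; lra). lra.
    - intros s Hs E. pose proof (HgC s (proj1 Hs)) as G1.
      assert (Ea : Rabs (u s) = g s).
      { assert (Es : Rsqr (Rabs (u s)) = Rsqr (g s)) by (rewrite -Rsqr_abs; unfold Rsqr; lra).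
        apply Rsqr_inj; [apply Rabs_pos|lra|exact Es]. }
      assert (B : Rabs (du s) <= C + K * g s).
      { rewrite -Ea. apply Hdu; [exact Hs|]. rewrite Ea.
        apply (Rle_lt_trans _ (g b)); [apply Hgb; lra|exact Hrho]. }
      assert (P : u s * du s <= g s * (C + K * g s)).
      { eapply Rle_trans; [apply Rle_abs|]. rewrite Rabs_mult Ea.
        apply Rmult_le_compat_l; lra. }
      assert (g s * (C + K * g s) < g s * ((K + 2) * g s)); [|lra].
      apply Rmult_lt_compat_l; lra.
    - exact Ht. }
  apply (Rle_trans _ (g t)); [|apply Hgb; lra].
  pose proof (HgC t (proj1 Ht)) as G1.
  apply Rsqr_incr_0; [|apply Rabs_pos|lra]. rewrite -Rsqr_abs. unfold Rsqr. lra.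
Qed.

Lemma continuous_bounded (f : R -> R) a b : a <= b -> (forall t, continuous f t) ->
  exists M, 0 < M /\ forall t, a <= t <= b -> Rabs (f t) <= M.
Proof.
  intros Hab Hf.
  destruct (continuity_ab_maj (fun t => Rabs (f t)) a b Hab) as [m [Hm _]].
  - intros t _. apply continuity_pt_filterlim.
    apply (continuous_comp f Rabs); [apply Hf|apply (continuous_Rabs (f t))].
  - exists (Rabs (f m) + 1). pose proof (Rabs_pos (f m)). split; [lra|].
    intros t Ht. pose proof (Hm t Ht). lra.
Qed.

(** * Uniform expansion of the Lagrangian along a curve *)

Lemma upd_at n (x : Rvec n) j s : upd x j s j = s.
Proof. unfold upd. now rewrite eqxx. Qed.

Lemma upd_twice n (x : Rvec n) j s r : upd (upd x j s) j r = upd x j r.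
Proof. apply functional_extensionality. intros k. unfold upd. now destruct (k == j). Qed.

Lemma upd_self n (x : Rvec n) j : upd x j (x j) = x.
Proof.
  apply functional_extensionality. intros k. unfold upd. case: eqP => [->|] //.
Qed.

Lemma upd_near n (x : Rvec n) j s d : 0 < d -> Rabs (s - x j) < d ->
  forall k, Rabs (upd x j s k - x k) < d.
Proof.
  intros Hd Hs k. unfold upd. case: eqP => [->|_] //. now rewrite Rminus_diag Rabs_R0.
Qed.

Lemma ord_common_delta n (P : 'I_n -> R -> Prop) :
  (forall k d d', 0 < d' <= d -> P k d -> P k d') ->
  (forall k, exists d, 0 < d /\ P k d) -> exists d, 0 < d /\ forall k, P k d.
Proof.
  intros Hmono H.
  assert (K : forall l : list 'I_n, exists d, 0 < d /\ forall k, k \in l -> P k d).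
  { induction l as [|i l [d [Hd Hl]]].
    - exists 1. split; [lra|]. intros k. rewrite in_nil. discriminate.
    - destruct (H i) as [d' [Hd' Hi]].
      assert (0 < Rmin d d') by (apply Rmin_pos; assumption).
      exists (Rmin d d'). split; [assumption|]. intros k. rewrite in_cons.
      move/orP => [/eqP ->|Hk].
      + apply (Hmono i d'); [|exact Hi]. split; [assumption|apply Rmin_r].
      + apply (Hmono k d); [|now apply Hl]. split; [assumption|apply Rmin_l]. }
  destruct (K (enum 'I_n)) as [d [Hd Hk]]. exists d. split; [exact Hd|].
  intros k. apply Hk. apply mem_enum.
Qed.

Lemma curve_cont n a b (x : R -> Rvec n) : (forall j, cont_on a b (fun t => x t j)) ->
  forall t, a <= t <= b -> forall eps, 0 < eps -> exists d, 0 < d /\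
    forall s, a <= s <= b -> Rabs (s - t) < d -> forall k, Rabs (x s k - x t k) < eps.
Proof.
  intros Hx t Ht eps He.
  destruct (ord_common_delta n (fun k d => forall s, a <= s <= b -> Rabs (s - t) < d ->
    Rabs (x s k - x t k) < eps)) as [d [Hd K]].
  - intros k d d' Hd K s Hs Hst. apply K; [exact Hs|lra].
  - intros k. apply (Hx k t Ht eps He).
  - exists d. split; [exact Hd|]. intros s Hs Hst k. now apply K.
Qed.

(** The neighbourhoods are centred at the curve point of time s rather than t; in this form
    compactness of [a,b] can make their size independent of t. *)
Lemma jcont_near_curve (n : nat) (a b : R) (x v : R -> Rvec n) (z : R -> R) (G : Lagr n) :
  (forall j, cont_on a b (fun t => x t j)) -> (forall j, cont_on a b (fun t => v t j)) ->
  cont_on a b z -> jcont_on a b G ->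
  forall t, a <= t <= b -> forall eps, 0 < eps -> exists d, 0 < d /\
    forall s, a <= s <= b -> Rabs (s - t) < d ->
    forall x' v' z', (forall k, Rabs (x' k - x s k) < d) -> (forall k, Rabs (v' k - v s k) < d) ->
      Rabs (z' - z s) < d -> Rabs (G s x' v' z' - G t (x t) (v t) (z t)) < eps.
Proof.
  intros Hx Hv Hz HG t Ht eps He.
  destruct (HG t (x t) (v t) (z t) Ht eps He) as [d [Hd K]].
  assert (Hd2 : 0 < d / 2) by lra.
  destruct (curve_cont n a b x Hx t Ht _ Hd2) as [d1 [Hd1 K1]].
  destruct (curve_cont n a b v Hv t Ht _ Hd2) as [d2 [Hd2' K2]].
  destruct (Hz t Ht _ Hd2) as [d3 [Hd3 K3]].
  set (m := Rmin (Rmin d1 d2) (Rmin d3 (d / 2))).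
  assert (0 < m) by (repeat apply Rmin_pos; assumption).
  assert (m <= d1) by (eapply Rle_trans; [apply Rmin_l|apply Rmin_l]).
  assert (m <= d2) by (eapply Rle_trans; [apply Rmin_l|apply Rmin_r]).
  assert (m <= d3) by (eapply Rle_trans; [apply Rmin_r|apply Rmin_l]).
  assert (m <= d / 2) by (eapply Rle_trans; [apply Rmin_r|apply Rmin_r]).
  exists m. split; [assumption|].
  assert (T : forall p q r, Rabs (p - q) < m -> Rabs (q - r) < d / 2 -> Rabs (p - r) < d).
  { intros p q r A B. replace (p - r) with ((p - q) + (q - r)) by ring.
    eapply Rle_lt_trans; [apply Rabs_triang|]. lra. }
  intros s Hs Hst x' v' z' Ax Av Az. apply K; [exact Hs|lra| | |].
  - intros k. apply (T _ (x s k)); [apply Ax|apply K1; lra].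
  - intros k. apply (T _ (v s k)); [apply Av|apply K2; lra].
  - apply (T _ (z s)); [apply Az|apply K3; lra].
Qed.

Lemma cont_on_along_curve (n : nat) (a b : R) (x v : R -> Rvec n) (z : R -> R) (G : Lagr n) :
  (forall j, cont_on a b (fun t => x t j)) -> (forall j, cont_on a b (fun t => v t j)) ->
  cont_on a b z -> jcont_on a b G ->
  cont_on a b (fun t => G t (x t) (v t) (z t)).
Proof.
  intros Hx Hv Hz HG t Ht eps He. destruct (jcont_near_curve n a b x v z G Hx Hv Hz HG t Ht eps He) as [d [Hd K]].
  exists d. split; [exact Hd|]. intros s Hs Hst.
  apply K; try assumption; intros; rewrite Rminus_diag Rabs_R0; exact Hd.
Qed.

Lemma uniform_near_curve (n : nat) (a b : R) (x v : R -> Rvec n) (z : R -> R) (G : Lagr n) :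
  (forall j, cont_on a b (fun t => x t j)) -> (forall j, cont_on a b (fun t => v t j)) ->
  cont_on a b z -> jcont_on a b G ->
  forall eps, 0 < eps -> exists d, 0 < d /\ forall t, a <= t <= b ->
    forall x' v' z', (forall k, Rabs (x' k - x t k) < d) -> (forall k, Rabs (v' k - v t k) < d) ->
      Rabs (z' - z t) < d -> Rabs (G t x' v' z' - G t (x t) (v t) (z t)) < eps.
Proof.
  intros Hx Hv Hz HG eps He.
  (* The compactness lemma takes a gauge defined on all of R, so a dummy radius is supplied outside
     [a,b]. *)
  assert (H : forall t, exists d : posreal, a <= t <= b ->
    forall s, a <= s <= b -> Rabs (s - t) < d ->
    forall x' v' z', (forall k, Rabs (x' k - x s k) < d) -> (forall k, Rabs (v' k - v s k) < d) ->
      Rabs (z' - z s) < d -> Rabs (G s x' v' z' - G t (x t) (v t) (z t)) < eps / 2).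
  { intros t. destruct (Rle_dec a t) as [L1|L1]; [destruct (Rle_dec t b) as [L2|L2]|].
    - destruct (jcont_near_curve n a b x v z G Hx Hv Hz HG t (conj L1 L2) (eps / 2) ltac:(lra)) as [d [Hd K]].
      exists (mkposreal d Hd). intros _. exact K.
    - exists (mkposreal 1 Rlt_0_1). intros; lra.
    - exists (mkposreal 1 Rlt_0_1). intros; lra. }
  pose (rho := fun t => proj1_sig (constructive_indefinite_description _ (H t))).
  assert (Hrho : forall t, a <= t <= b -> forall s, a <= s <= b -> Rabs (s - t) < rho t ->
    forall x' v' z', (forall k, Rabs (x' k - x s k) < rho t) -> (forall k, Rabs (v' k - v s k) < rho t) ->
      Rabs (z' - z s) < rho t -> Rabs (G s x' v' z' - G t (x t) (v t) (z t)) < eps / 2).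
  { intros t. exact (proj2_sig (constructive_indefinite_description _ (H t))). }
  destruct (compactness_value_1d a b rho) as [d Hd].
  exists d. split; [apply cond_pos|]. intros s Hs x' v' z' Ax Av Az.
  (* Compactness provides, up to double negation, a reference time t whose gauge covers s. The
     perturbed value at s and the value on the curve at s are both within eps / 2 of the value at
     t. *)
  destruct (NNPP _ (Hd s Hs)) as [t [Ht [Hst Hdt]]].
  pose proof (cond_pos (rho t)) as Hp.
  assert (K1 : Rabs (G s x' v' z' - G t (x t) (v t) (z t)) < eps / 2).
  { apply Hrho; try assumption.
    - intros k. eapply Rlt_le_trans; [apply Ax|exact Hdt].
    - intros k. eapply Rlt_le_trans; [apply Av|exact Hdt].
    - eapply Rlt_le_trans; [apply Az|exact Hdt]. }
  assert (K2 : Rabs (G s (x s) (v s) (z s) - G t (x t) (v t) (z t)) < eps / 2).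
  { apply Hrho; try assumption; intros; rewrite Rminus_diag Rabs_R0; exact Hp. }
  replace (G s x' v' z' - G s (x s) (v s) (z s)) with
    ((G s x' v' z' - G t (x t) (v t) (z t)) - (G s (x s) (v s) (z s) - G t (x t) (v t) (z t))) by ring.
  unfold Rminus at 1. eapply Rle_lt_trans; [apply Rabs_triang|]. rewrite Rabs_Ropp. lra.
Qed.

Lemma MVT_increment (f : R -> R) y p : (forall s, ex_derive f s) ->
  exists xi, Rabs (xi - y) <= Rabs p /\ f (y + p) - f y = Derive f xi * p.
Proof.
  intros Hf. destruct (MVT_gen f y (y + p) (Derive f)) as [xi [Hxi E]].
  - intros s _. apply Derive_correct, Hf.
  - intros s _. apply continuity_pt_filterlim.
    exact (is_derive_continuous _ _ _ (Derive_correct _ _ (Hf s))).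
  - exists xi. split.
    + revert Hxi. unfold Rmin, Rmax, Rabs. repeat destruct Rle_dec; repeat destruct Rcase_abs; lra.
    + rewrite E. f_equal. ring.
Qed.

(** Telescoping: the three arguments are changed one at a time with the mean value theorem for each,
    so the partial derivatives are taken at mixed points. The bounds on xi, et, ze keep these points
    close to (X, V, Z). *)
Lemma Lagr_increment n a b (L : Lagr n) j t X V Z p q s : C1_Lagr a b L -> a <= t <= b ->
  exists xi et ze, Rabs (xi - X j) <= Rabs p /\ Rabs (et - V j) <= Rabs q /\ Rabs (ze - Z) <= Rabs s /\
    L t (upd X j (X j + p)) (upd V j (V j + q)) (Z + s) - L t X V Z =
    dLx L j t (upd X j xi) (upd V j (V j + q)) (Z + s) * p
    + dLv L j t X (upd V j et) (Z + s) * q + dLz L t X V ze * s.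
Proof.
  intros [_ [_ [HLx [HLv [HLz _]]]]] Ht.
  destruct (MVT_increment (fun r => L t (upd X j r) (upd V j (V j + q)) (Z + s)) (X j) p)
    as [xi [B1 E1]].
  { intros r. pose proof (proj1 (HLx j) t (upd X j r) (upd V j (V j + q)) (Z + s) Ht) as K.
    rewrite upd_at in K. eapply ex_derive_ext; [|exact K]. intros; simpl. now rewrite upd_twice. }
  destruct (MVT_increment (fun r => L t X (upd V j r) (Z + s)) (V j) q) as [et [B2 E2]].
  { intros r. pose proof (proj1 (HLv j) t X (upd V j r) (Z + s) Ht) as K.
    rewrite upd_at in K. eapply ex_derive_ext; [|exact K]. intros; simpl. now rewrite upd_twice. }
  destruct (MVT_increment (fun r => L t X V r) Z s) as [ze [B3 E3]].
  { intros r. now apply HLz. }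
  exists xi, et, ze. repeat split; try assumption.
  cbv beta in E1, E2, E3. rewrite !upd_self in E1, E2.
  assert (D1 : dLx L j t (upd X j xi) (upd V j (V j + q)) (Z + s) =
    Derive (fun r => L t (upd X j r) (upd V j (V j + q)) (Z + s)) xi).
  { unfold dLx. rewrite upd_at. apply Derive_ext. intros; now rewrite upd_twice. }
  assert (D2 : dLv L j t X (upd V j et) (Z + s) = Derive (fun r => L t X (upd V j r) (Z + s)) et).
  { unfold dLv. rewrite upd_at. apply Derive_ext. intros; now rewrite upd_twice. }
  rewrite D1 D2. unfold dLz. lra.
Qed.

Lemma Lagr_uniform_expansion n a b (L : Lagr n) j (x v : R -> Rvec n) (z : R -> R) :
  C1_Lagr a b L -> (forall k, cont_on a b (fun t => x t k)) ->
  (forall k, cont_on a b (fun t => v t k)) -> cont_on a b z ->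
  forall eps, 0 < eps -> exists d, 0 < d /\ forall t p q s, a <= t <= b ->
    Rabs p < d -> Rabs q < d -> Rabs s < d ->
    Rabs (L t (upd (x t) j (x t j + p)) (upd (v t) j (v t j + q)) (z t + s) - L t (x t) (v t) (z t)
      - (dLx L j t (x t) (v t) (z t) * p + dLv L j t (x t) (v t) (z t) * q
         + dLz L t (x t) (v t) (z t) * s))
    <= eps * (Rabs p + Rabs q + Rabs s).
Proof.
  intros HL Hx Hv Hz eps He. pose proof HL as [_ [_ [HLx [HLv [_ HLz]]]]].
  destruct (uniform_near_curve n a b x v z _ Hx Hv Hz (proj2 (HLx j)) eps He) as [d1 [Hd1 K1]].
  destruct (uniform_near_curve n a b x v z _ Hx Hv Hz (proj2 (HLv j)) eps He) as [d2 [Hd2 K2]].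
  destruct (uniform_near_curve n a b x v z _ Hx Hv Hz HLz eps He) as [d3 [Hd3 K3]].
  set (m := Rmin d1 (Rmin d2 d3)).
  assert (0 < m) by (repeat apply Rmin_pos; assumption).
  assert (m <= d1) by apply Rmin_l.
  assert (m <= d2) by (eapply Rle_trans; [apply Rmin_r|apply Rmin_l]).
  assert (m <= d3) by (eapply Rle_trans; [apply Rmin_r|apply Rmin_r]).
  exists m. split; [assumption|]. intros t p q s Ht Hp Hq Hs.
  destruct (Lagr_increment n a b L j t (x t) (v t) (z t) p q s HL Ht)
    as [xi [et [ze [B1 [B2 [B3 ->]]]]]].
  set (Lx := dLx L j t (upd (x t) j xi) (upd (v t) j (v t j + q)) (z t + s)) in *.
  set (Lv := dLv L j t (x t) (upd (v t) j et) (z t + s)) in *.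
  set (Lz := dLz L t (x t) (v t) ze) in *.
  assert (Z0 : forall r d, 0 < d -> Rabs (r - r) < d).
  { intros r d Hd. now rewrite Rminus_diag Rabs_R0. }
  assert (Zs : forall r p' d, Rabs p' < d -> Rabs (r + p' - r) < d).
  { intros r p' d Hd. now replace (r + p' - r) with p' by ring. }
  assert (A1 : Rabs (Lx - dLx L j t (x t) (v t) (z t)) < eps).
  { apply K1; [exact Ht| | |].
    - apply upd_near; lra.
    - apply upd_near; [exact Hd1|]. apply Zs; lra.
    - apply Zs; lra. }
  assert (A2 : Rabs (Lv - dLv L j t (x t) (v t) (z t)) < eps).
  { apply K2; [exact Ht| | |].
    - intros; now apply Z0.
    - apply upd_near; lra.
    - apply Zs; lra. }
  assert (A3 : Rabs (Lz - dLz L t (x t) (v t) (z t)) < eps).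
  { apply K3; [exact Ht| | |].
    - intros; now apply Z0.
    - intros; now apply Z0.
    - lra. }
  set (Lx0 := dLx L j t (x t) (v t) (z t)) in *.
  set (Lv0 := dLv L j t (x t) (v t) (z t)) in *.
  set (Lz0 := dLz L t (x t) (v t) (z t)) in *.
  replace (Lx * p + Lv * q + Lz * s - (Lx0 * p + Lv0 * q + Lz0 * s)) with
    ((Lx - Lx0) * p + (Lv - Lv0) * q + (Lz - Lz0) * s) by ring.
  eapply Rle_trans; [apply Rabs_triang|].
  eapply Rle_trans; [apply Rplus_le_compat_r, Rabs_triang|]. rewrite !Rabs_mult.
  rewrite !Rmult_plus_distr_l.
  repeat apply Rplus_le_compat; apply Rmult_le_compat_r; try apply Rabs_pos; lra.
Qed.

Lemma cont_on_upd n a b (j : 'I_n) (x : R -> Rvec n) h e : a <= b ->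
  (forall i, cont_on a b (fun t => x t i)) -> cont_on a b h ->
  forall i, cont_on a b (fun t => upd (x t) j (x t j + e * h t) i).
Proof.
  intros Hab Hx Hh i. unfold upd. destruct (i == j); [|apply Hx].
  destruct (cont_on_extend a b _ Hab (Hx j)) as [X [HX EX]].
  destruct (cont_on_extend a b _ Hab Hh) as [Y [HY EY]].
  apply (cont_on_ext a b (fun t => X t + e * Y t)).
  - intros t Ht. now rewrite EX ?EY.
  - apply continuous_cont_on. intros t _. now apply continuous_affine.
Qed.

(** * Derivative of the terminal value with respect to the parameter *)

(** Let u be the difference of the solutions for e and 0. The Gronwall bound gives |u| = O(|e|),
    after which u' - B u - e A is o(e) uniformly in t; integrating against the factor exp(- int B)
    isolates u(b). A and B are global continuous extensions of the inhomogeneity and of L_z along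
    the reference curve. *)
Lemma first_variation n a b (L : Lagr n) j (x v : R -> Rvec n) (h k : R -> R)
  (zs : R -> R -> R) (za : R) (A B : R -> R) :
  a < b -> C1_Lagr a b L -> (forall i, cont_on a b (fun t => x t i)) ->
  (forall i, cont_on a b (fun t => v t i)) -> cont_on a b h -> cont_on a b k ->
  (forall e, zs e a = za) ->
  (forall e t, a <= t <= b -> has_deriv_within a b (zs e) t
    (L t (upd (x t) j (x t j + e * h t)) (upd (v t) j (v t j + e * k t)) (zs e t))) ->
  (forall t, continuous A t) -> (forall t, continuous B t) ->
  (forall t, a <= t <= b -> A t = dLx L j t (x t) (v t) (zs 0 t) * h t
                                 + dLv L j t (x t) (v t) (zs 0 t) * k t) ->
  (forall t, a <= t <= b -> B t = dLz L t (x t) (v t) (zs 0 t)) ->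
  is_derive (fun e => zs e b) 0
    (RInt (fun t => exp (- RInt B a t) * A t) a b / exp (- RInt B a b)).
Proof.
  intros Hab HL Hx Hv Hh Hk Hza Hode HA HB EA EB.
  assert (Hle : a <= b) by lra.
  assert (Hx' := fun e => cont_on_upd n a b j x h e Hle Hx Hh).
  assert (Hv' := fun e => cont_on_upd n a b j v k e Hle Hv Hk).
  assert (Hz : forall e, cont_on a b (zs e)).
  { intros e t Ht. exact (has_deriv_within_cont a b _ t _ (Hode e t Ht)). }
  assert (HZ : forall e, exists Z dZ : R -> R, (forall t, is_derive Z t (dZ t)) /\
    (forall t, a <= t <= b -> Z t = zs e t) /\
    (forall t, a <= t <= b -> dZ t =
      L t (upd (x t) j (x t j + e * h t)) (upd (v t) j (v t j + e * k t)) (zs e t))).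
  { intros e.
    destruct (C1_extend a b (zs e)
      (fun t => L t (upd (x t) j (x t j + e * h t)) (upd (v t) j (v t j + e * k t)) (zs e t)) Hab)
      as [Z [dZ [H1 [_ [H2 H3]]]]].
    - apply (cont_on_along_curve n a b (fun t => upd (x t) j (x t j + e * h t))
        (fun t => upd (v t) j (v t j + e * k t)) (zs e) L); auto. apply HL.
    - apply Hode.
    - exists Z, dZ. auto. }
  destruct (cont_on_extend a b h Hle Hh) as [hc [Hhc Ehc]].
  destruct (cont_on_extend a b k Hle Hk) as [kc [Hkc Ekc]].
  destruct (continuous_bounded hc a b Hle Hhc) as [H1 [H1p H1b]].
  destruct (continuous_bounded kc a b Hle Hkc) as [H2 [H2p H2b]].
  destruct (continuous_bounded A a b Hle HA) as [MA [MAp MAb]].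
  destruct (continuous_bounded B a b Hle HB) as [MB [MBp MBb]].
  set (lam := fun t => exp (- RInt B a t)).
  assert (Hlam : forall t, is_derive lam t (- B t * lam t)).
  { intros t. unfold lam.
    apply (is_derive_eq _ _ (scal (opp (B t)) (exp (- RInt B a t)))); [reflexivity|].
    apply (is_derive_comp exp (fun t => - RInt B a t)).
    - apply is_derive_Reals. apply derivable_pt_lim_exp.
    - apply (is_derive_opp (K := R_AbsRing) (V := R_NormedModule) (fun t => RInt B a t)).
      now apply is_derive_prim. }
  assert (Hlamc : forall t, continuous lam t).
  { intros t. exact (is_derive_continuous _ _ _ (Hlam t)). }
  destruct (continuous_bounded lam a b Hle Hlamc) as [ML [MLp MLb]].
  assert (Hlampos : forall t, 0 < lam t) by (intros; apply exp_pos).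
  set (H := Rmax H1 H2).
  assert (Hp : 0 < H) by (apply (Rlt_le_trans _ H1); [exact H1p|apply Rmax_l]).
  assert (Hhb : forall e t, a <= t <= b -> Rabs (e * h t) <= Rabs e * H).
  { intros e t Ht. rewrite Rabs_mult. apply Rmult_le_compat_l; [apply Rabs_pos|].
    rewrite -Ehc; [|exact Ht]. apply (Rle_trans _ H1); [now apply H1b|apply Rmax_l]. }
  assert (Hkb : forall e t, a <= t <= b -> Rabs (e * k t) <= Rabs e * H).
  { intros e t Ht. rewrite Rabs_mult. apply Rmult_le_compat_l; [apply Rabs_pos|].
    rewrite -Ekc; [|exact Ht]. apply (Rle_trans _ H2); [now apply H2b|apply Rmax_r]. }
  destruct (HZ 0) as [Z0 [dZ0 [DZ0 [EZ0 EdZ0]]]].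
  (* The linearisation error is kept for arbitrary eps since it serves twice: with eps = 1 for the a
     priori bound, and with a small eps for the limit. *)
  assert (Hexp : forall eps, 0 < eps -> exists d, 0 < d /\ forall e Z dZ t,
    (forall t, a <= t <= b -> Z t = zs e t) ->
    (forall t, a <= t <= b -> dZ t =
      L t (upd (x t) j (x t j + e * h t)) (upd (v t) j (v t j + e * k t)) (zs e t)) ->
    a <= t <= b -> Rabs e * H < d -> Rabs (Z t - Z0 t) < d ->
    Rabs (dZ t - dZ0 t - B t * (Z t - Z0 t) - e * A t) <=
      eps * (2 * (Rabs e * H) + Rabs (Z t - Z0 t))).
  { intros eps He.
    destruct (Lagr_uniform_expansion n a b L j x v (zs 0) HL Hx Hv (Hz 0) eps He) as [d [Hd K]].
    exists d. split; [exact Hd|]. intros e Z dZ t EZ EdZ Ht He1 Hu.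
    pose proof (Hhb e t Ht) as Bh. pose proof (Hkb e t Ht) as Bk.
    pose proof (K t (e * h t) (e * k t) (Z t - Z0 t) Ht ltac:(lra) ltac:(lra) Hu) as Kt.
    assert (Ez : zs 0 t + (Z t - Z0 t) = zs e t) by (rewrite EZ; [rewrite EZ0; [ring|exact Ht]|exact Ht]).
    rewrite Ez in Kt. rewrite EdZ; [|exact Ht]. rewrite EdZ0; [|exact Ht].
    rewrite !Rmult_0_l !Rplus_0_r !upd_self EB; [|exact Ht]. rewrite EA; [|exact Ht].
    eapply Rle_trans; [|eapply Rle_trans; [exact Kt|]].
    - right. f_equal. ring.
    - apply Rmult_le_compat_l; lra. }
  (* With eps = 1 the expansion yields |u'| <= |e| (MA + 2 H) + (MB + 1) |u|, whence [C0] and,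
     through [local_gronwall], the exponential factor [X]. *)
  destruct (Hexp 1 Rlt_0_1) as [d1 [Hd1 K1]].
  set (X := exp ((MB + 1 + 2) * (b - a))).
  assert (HX : 0 < X) by apply exp_pos.
  set (C0 := MA + 2 * H).
  assert (HC0 : 0 < C0) by (unfold C0; lra).
  (* |e| M dominates the sum 2 |e| H + |u| in the error estimate, so |e| < d / M brings all
     increments within the range of both expansions. *)
  set (M := 2 * H + C0 * X).
  assert (HC0X : 0 < C0 * X) by now apply Rmult_lt_0_compat.
  assert (HM : 0 < M) by (unfold M; lra).
  apply is_derive_eps. intros eps He.
  (* Solved from the final estimate: ML eps2 |e| M (b - a) / lam(b) must equal eps |e|. *)
  set (eps2 := eps * lam b / ((b - a) * ML * M)).
  assert (Hden : 0 < (b - a) * ML * M).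
  { apply Rmult_lt_0_compat; [apply Rmult_lt_0_compat|]; lra. }
  assert (He2 : 0 < eps2).
  { apply Rdiv_lt_0_compat; [|exact Hden]. now apply Rmult_lt_0_compat. }
  destruct (Hexp eps2 He2) as [d2 [Hd2 K2]].
  set (d := Rmin d1 d2).
  assert (Hd : 0 < d) by now apply Rmin_pos.
  assert (Hdd1 : d <= d1) by apply Rmin_l. assert (Hdd2 : d <= d2) by apply Rmin_r.
  exists (d / M). split; [now apply Rdiv_lt_0_compat|].
  intros e He0. rewrite !Rminus_0_r in He0. rewrite !Rminus_0_r.
  destruct (Req_dec e 0) as [->|Ne].
  { rewrite Rminus_diag Rmult_0_r Rminus_0_r Rabs_R0. lra. }
  assert (Hep : 0 < Rabs e) by now apply Rabs_pos_lt.
  assert (HeM : Rabs e * M < d).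
  { apply (Rlt_le_trans _ (d / M * M)); [now apply Rmult_lt_compat_r|]. right. field. lra. }
  assert (HeH : Rabs e * H < d).
  { eapply Rle_lt_trans; [|exact HeM]. apply Rmult_le_compat_l; [lra|]. unfold M; lra. }
  assert (HeX : Rabs e * (C0 * X) < d).
  { eapply Rle_lt_trans; [|exact HeM]. apply Rmult_le_compat_l; [lra|]. unfold M; lra. }
  destruct (HZ e) as [Z [dZ [DZ [EZ EdZ]]]].
  set (u := fun t => Z t - Z0 t).
  set (du := fun t => dZ t - dZ0 t).
  assert (Du : forall t, is_derive u t (du t)).
  { intros t. apply (is_derive_minus (K := R_AbsRing) (V := R_NormedModule) Z Z0); auto. }
  assert (Hua : u a = 0).
  { unfold u. rewrite EZ; [|lra]. rewrite EZ0; [|lra]. rewrite !Hza. ring. }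
  assert (Hub : forall t, a <= t <= b -> Rabs (u t) <= Rabs e * (C0 * X)).
  { intros t Ht. replace (Rabs e * (C0 * X)) with (Rabs e * C0 * X) by ring.
    apply (local_gronwall u du a b (Rabs e * C0) (MB + 1) d1); try assumption; try lra.
    - now apply Rmult_lt_0_compat.
    - intros s _. apply Du.
    - intros s Hs Hus.
      pose proof (K1 e Z dZ s EZ EdZ Hs ltac:(lra) Hus) as Ks.
      fold (u s) (du s) in Ks.
      replace (du s) with ((du s - B s * u s - e * A s) + B s * u s + e * A s) by ring.
      eapply Rle_trans; [apply Rabs_triang|].
      eapply Rle_trans; [apply Rplus_le_compat_r, Rabs_triang|]. rewrite !Rabs_mult.
      assert (Rabs (B s) * Rabs (u s) <= MB * Rabs (u s)).
      { apply Rmult_le_compat_r; [apply Rabs_pos|now apply MBb]. }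
      assert (Rabs e * Rabs (A s) <= Rabs e * MA).
      { apply Rmult_le_compat_l; [lra|now apply MAb]. }
      unfold C0. lra.
    - fold X. replace (Rabs e * C0 * X) with (Rabs e * (C0 * X)) by ring. lra. }
  assert (HlA : forall t, continuous (fun t => lam t * A t) t).
  { intros t. apply (continuous_mult (K := R_AbsRing) lam A); auto. }
  (* The integrating factor absorbs B u: the derivative of [phi] is [lam] times the linearisation
     error. As [phi a = 0], the mean value theorem bounds [phi b]. *)
  set (phi := fun t => lam t * u t - e * RInt (fun t => lam t * A t) a t).
  assert (Dphi : forall t, is_derive phi t (lam t * (du t - B t * u t - e * A t))).
  { intros t. apply (is_derive_eq _ _ ((- B t * lam t * u t + lam t * du t) - e * (lam t * A t))); [ring|].
    apply (is_derive_minus (K := R_AbsRing) (V := R_NormedModule) (fun t => lam t * u t)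
      (fun t => e * RInt (fun t => lam t * A t) a t)).
    - apply (is_derive_mult lam u); [apply Hlam|apply Du|intros; apply Rmult_comm].
    - apply (is_derive_scal (fun t => RInt (fun t => lam t * A t) a t)).
      now apply (is_derive_prim (fun t => lam t * A t)). }
  assert (Hphia : phi a = 0).
  { unfold phi. rewrite Hua RInt_point. unfold zero; simpl. ring. }
  assert (Hphib : Rabs (phi b) <= ML * (eps2 * (Rabs e * M)) * (b - a)).
  { destruct (MVT_gen phi a b (fun t => lam t * (du t - B t * u t - e * A t))) as [xi [Hxi E]].
    - intros t _. apply Dphi.
    - intros t _. apply continuity_pt_filterlim. exact (is_derive_continuous _ _ _ (Dphi t)).
    - rewrite Rmin_left in Hxi; [|lra]. rewrite Rmax_right in Hxi; [|lra].
      rewrite Hphia Rminus_0_r in E. rewrite E Rabs_mult (Rabs_right (b - a)); [|lra].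
      apply Rmult_le_compat_r; [lra|]. rewrite Rabs_mult.
      apply Rmult_le_compat; try apply Rabs_pos; [now apply MLb|].
      pose proof (Hub xi Hxi) as Bu.
      eapply Rle_trans; [apply (K2 e Z dZ xi EZ EdZ Hxi); [lra|fold (u xi); lra]|].
      apply Rmult_le_compat_l; [lra|]. fold (u xi). unfold M. lra. }
  rewrite -(EZ b); [|lra]. rewrite -(EZ0 b); [|lra]. fold (u b). fold (lam b).
  replace (RInt (fun t => exp (- RInt B a t) * A t) a b) with (RInt (fun t => lam t * A t) a b)
    by reflexivity.
  pose proof (Hlampos b) as Hlb.
  replace (u b - RInt (fun t => lam t * A t) a b / lam b * e) with (phi b / lam b)
    by (unfold phi; field; lra).
  unfold Rdiv. rewrite Rabs_mult (Rabs_right (/ lam b)).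
  2: { apply Rle_ge. left. now apply Rinv_0_lt_compat. }
  apply (Rle_trans _ (ML * (eps2 * (Rabs e * M)) * (b - a) * / lam b)).
  - apply Rmult_le_compat_r; [left; now apply Rinv_0_lt_compat|exact Hphib].
  - right. unfold eps2. field. repeat split; lra.
Qed.

(** * Linearity of the Caputo derivative *)

(** [Derive f] is two-sided and says nothing about [a,b] at its endpoints, but the improper integral
    sees only the open interval (a,t), where it coincides with the relative derivative. *)
Lemma ex_RInt_gen_caputo a b alpha f : alpha < 1 -> C1_on a b f -> forall t, a < t <= b ->
  ex_RInt_gen (fun tau => Rpower (t - tau) (- alpha) * Derive f tau) (at_point a) (at_left t).
Proof.
  intros Ha [f' [Hc Hd]] t Ht.
  destruct (cont_on_extend a b f' ltac:(lra) Hc) as [F [HF EF]].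
  destruct (ex_RInt_gen_sing_right F alpha a t Ha (proj1 Ht) HF) as [l Hl].
  exists l. refine (is_RInt_gen_ext (V := R_NormedModule) _ _ _ _ Hl).
  apply (Filter_prod _ _ _ (fun x => x = a) (fun x => a < x < t)).
  - reflexivity.
  - apply at_left_interval; lra.
  - intros u w -> Hw s Hs. simpl in Hs. rewrite Rmin_left in Hs; [|lra]. rewrite Rmax_right in Hs; [|lra].
    f_equal. symmetry. apply is_derive_unique. rewrite EF; [|lra].
    apply (within_is_derive a b); [lra|]. apply Hd. lra.
Qed.

Lemma caputo_linear a b alpha f g e : alpha < 1 -> C1_on a b f -> C1_on a b g ->
  forall t, a <= t <= b ->
  caputo alpha a (fun s => f s + e * g s) t = caputo alpha a f t + e * caputo alpha a g t.
Proof.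
  intros Ha Hf Hg t Ht. unfold caputo, int_sing_right. destruct Rlt_dec as [L|L]; [|ring].
  destruct (ex_RInt_gen_caputo a b alpha f Ha Hf t ltac:(lra)) as [lf If].
  destruct (ex_RInt_gen_caputo a b alpha g Ha Hg t ltac:(lra)) as [lg Ig].
  rewrite (is_RInt_gen_unique (V := R_CompleteNormedModule) _ lf If).
  rewrite (is_RInt_gen_unique (V := R_CompleteNormedModule) _ lg Ig).
  pose proof (is_RInt_gen_plus (V := R_NormedModule) _ _ _ _ If
    (is_RInt_gen_scal (V := R_NormedModule) _ e _ Ig)) as Is.
  rewrite (is_RInt_gen_unique (V := R_CompleteNormedModule)
    (fun tau => Rpower (t - tau) (- alpha) * Derive (fun s => f s + e * g s) tau) (plus lf (scal e lg))).
  - unfold plus, scal; simpl; unfold mult; simpl. ring.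
  - refine (is_RInt_gen_ext (V := R_NormedModule) _ _ _ _ Is).
    apply (Filter_prod _ _ _ (fun x => x = a) (fun x => a < x < t)).
    + reflexivity.
    + apply at_left_interval; lra.
    + intros u w -> Hw s Hs. simpl in Hs. rewrite Rmin_left in Hs; [|lra]. rewrite Rmax_right in Hs; [|lra].
      destruct Hf as [f' [_ Hf]]. destruct Hg as [g' [_ Hg]].
      pose proof (within_is_derive a b f s _ ltac:(lra) (Hf s ltac:(lra))) as Df.
      pose proof (within_is_derive a b g s _ ltac:(lra) (Hg s ltac:(lra))) as Dg.
      rewrite (is_derive_unique _ _ _ Df) (is_derive_unique _ _ _ Dg).
      rewrite (is_derive_unique (fun s => f s + e * g s) s (f' s + e * g' s)).
      * unfold plus, scal; simpl; unfold mult; simpl. ring.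
      * apply (is_derive_plus (K := R_AbsRing) (V := R_NormedModule) f (fun s => e * g s)); [exact Df|].
        now apply (is_derive_scal g).
Qed.

Lemma C1_on_linear a b f g e : a < b -> C1_on a b f -> C1_on a b g ->
  C1_on a b (fun t => f t + e * g t).
Proof.
  intros Hab [f' [Cf Df]] [g' [Cg Dg]].
  destruct (C1_extend a b f f' Hab Cf Df) as [F [F' [HF [HF' [EF _]]]]].
  destruct (C1_extend a b g g' Hab Cg Dg) as [G [G' [HG [HG' [EG _]]]]].
  apply (C1_on_ext a b (fun t => F t + e * G t)).
  { intros t Ht. now rewrite EF ?EG. }
  apply (is_derive_C1_on a b _ (fun t => F' t + e * G' t)).
  - intros t _. apply (is_derive_plus (K := R_AbsRing) (V := R_NormedModule) F (fun t => e * G t)); [apply HF|].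
    apply (is_derive_scal G), HG.
  - intros t _. now apply continuous_affine.
Qed.

Lemma caputo_zero a b alpha : alpha < 1 -> a < b -> forall t, a <= t <= b ->
  caputo alpha a (fun _ => 0) t = 0.
Proof.
  intros Ha Hab t Ht.
  assert (H0 : C1_on a b (fun _ => 0)).
  { apply (is_derive_C1_on a b _ (fun _ => 0)); intros; [apply @is_derive_const|apply continuous_const]. }
  (* Linearity with zero functions and coefficient -1 reads c = c - c. *)
  pose proof (caputo_linear a b alpha (fun _ => 0) (fun _ => 0) (-1) Ha H0 H0 t Ht) as E.
  assert (E0 : (fun s : R => 0 + -1 * 0) = (fun _ => 0)).
  { apply functional_extensionality. intros _. ring. }
  cbv beta in E. rewrite E0 in E. lra.
Qed.

(** * Variations of a single coordinate *)

Definition single_variation {n : nat} (j : 'I_n) (h : R -> R) : R -> Rvec n :=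
  fun t k => if k == j then h t else 0.

Section SingleVariation.
Context {n : nat} (alpha : Rvec n) (a b : R) (j : 'I_n) (h : R -> R).
Context (Hab : a < b) (Halpha : forall k, 0 < alpha k < 1).
Context (Hh : C1_on a b h) (Hch : C1_on a b (caputo (alpha j) a h)).

Lemma single_variation_C1 : C1_vec_on a b (single_variation j h).
Proof.
  intros k. unfold single_variation. destruct (k == j); [exact Hh|].
  apply (is_derive_C1_on a b _ (fun _ => 0)); intros; [apply @is_derive_const|apply continuous_const].
Qed.

Lemma caputo_single_variation t k : a <= t <= b ->
  caputo_vec alpha a (single_variation j h) t k = if k == j then caputo (alpha j) a h t else 0.
Proof.
  intros Ht. unfold caputo_vec, single_variation. case: eqP => [->|_] //.
  apply (caputo_zero a b); [apply Halpha|exact Hab|exact Ht].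
Qed.

Lemma caputo_single_variation_C1 : C1_vec_on a b (caputo_vec alpha a (single_variation j h)).
Proof.
  intros k. apply (C1_on_ext a b (fun t => if k == j then caputo (alpha j) a h t else 0)).
  { intros t Ht. now rewrite caputo_single_variation. }
  destruct (k == j); [exact Hch|].
  apply (is_derive_C1_on a b _ (fun _ => 0)); intros; [apply @is_derive_const|apply continuous_const].
Qed.

Lemma variation_single : h a = 0 -> h b = 0 -> variation alpha a b (single_variation j h).
Proof.
  intros Ea Eb. split; [exact single_variation_C1|]. split; [exact caputo_single_variation_C1|].
  unfold single_variation. split; intros k; now destruct (k == j).
Qed.

Lemma perturb_single x e t :
  perturb x (single_variation j h) e t = upd (x t) j (x t j + e * h t).
Proof.
  apply functional_extensionality. intros k. unfold perturb, single_variation, upd.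
  case: eqP => [->|_] //. ring.
Qed.

Lemma caputo_perturb_single x e t : C1_vec_on a b x -> a <= t <= b ->
  caputo_vec alpha a (perturb x (single_variation j h) e) t =
  upd (caputo_vec alpha a x t) j (caputo_vec alpha a x t j + e * caputo (alpha j) a h t).
Proof.
  intros Hx Ht. apply functional_extensionality. intros k.
  pose proof (caputo_linear a b (alpha k) (fun s => x s k) (fun s => single_variation j h s k) e
    (proj2 (Halpha k)) (Hx k) (single_variation_C1 k) t Ht) as E.
  pose proof (caputo_single_variation t k Ht) as E2. unfold caputo_vec in E2. rewrite E2 in E.
  unfold caputo_vec at 1, perturb. rewrite E. unfold upd, caputo_vec.
  case: eqP => [->|_] //. ring.
Qed.

Lemma admissible_perturb_single xa xb x e : h a = 0 -> h b = 0 ->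
  admissible alpha a b xa xb x -> admissible alpha a b xa xb (perturb x (single_variation j h) e).
Proof.
  intros Ea Eb [Hx [Hcx [Exa Exb]]]. repeat split.
  - intros k. apply (C1_on_linear a b (fun t => x t k)); [exact Hab|apply Hx|apply single_variation_C1].
  - intros k.
    apply (C1_on_ext a b (fun t => caputo_vec alpha a x t k +
      e * caputo_vec alpha a (single_variation j h) t k)).
    + intros t Ht. symmetry. apply (caputo_linear a b); [apply Halpha|apply Hx|apply single_variation_C1|exact Ht].
    + apply C1_on_linear; [exact Hab|apply Hcx|apply caputo_single_variation_C1].
  - rewrite perturb_single Ea Rmult_0_r Rplus_0_r upd_self. exact Exa.
  - rewrite perturb_single Eb Rmult_0_r Rplus_0_r upd_self. exact Exb.
Qed.

End SingleVariation.

(** Equality of functions, not merely pointwise equality, is wanted because [zsol] takes the whole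
    curve as its argument. *)
Lemma perturb_0 n (x eta : R -> Rvec n) : perturb x eta 0 = x.
Proof.
  apply functional_extensionality. intros t. apply functional_extensionality. intros k.
  unfold perturb. ring.
Qed.

(** * Fractional Euler-Lagrange equation for the terminal value of the Cauchy problem *)

Theorem theorem3p1
  (a b : R) (n : nat) (alpha : Rvec n) (za : R) (xa xb : Rvec n)
  (L : Lagr n) (zsol : (R -> Rvec n) -> R -> R) (x : R -> Rvec n) :
  a < b ->
  (forall j, 0 < alpha j < 1) ->
  C1_Lagr a b L ->
  (* z[y; .] is the solution of the Cauchy problem for every admissible y *)
  (forall y, admissible alpha a b xa xb y -> is_solution L alpha a b za y (zsol y)) ->
  admissible alpha a b xa xb x ->
  (* differentiable dependence of the solution on the parameter eps *)
  (forall eta, variation alpha a b eta ->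
     forall eps t, a <= t <= b -> ex_derive (fun e => zsol (perturb x eta e) t) eps) ->
  (* the right RL derivatives exist and are continuous on [a,b] *)
  (let lambda := fun t =>
       exp (- RInt (fun tau => dLz L tau (x tau) (caputo_vec alpha a x tau) (zsol x tau)) a t) in
   (forall j : 'I_n, exists D : R -> R, cont_on a b D /\
      is_right_RL_deriv (alpha j) a b
        (fun t => lambda t * dLv L j t (x t) (caputo_vec alpha a x t) (zsol x t)) D) ->
  (* x is an extremizer of z[.; b] *)
  (forall eta, variation alpha a b eta ->
     Derive (fun e => zsol (perturb x eta e) b) 0 = 0) ->
  forall (j : 'I_n) (D : R -> R),
    is_right_RL_deriv (alpha j) a b
      (fun t => lambda t * dLv L j t (x t) (caputo_vec alpha a x t) (zsol x t)) D ->
    forall t, a <= t <= b ->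
      lambda t * dLx L j t (x t) (caputo_vec alpha a x t) (zsol x t) + D t = 0).
Proof.
  intros Hab Halpha HL Hsol Hadm _ lambda HRLc Hext j D HD.
  pose proof Hadm as [Hx [Hcx _]].
  assert (Hle : a <= b) by lra.
  set (v := caputo_vec alpha a x) in *.
  set (z := zsol x) in *.
  destruct (Hsol x Hadm) as [_ Hz0]. fold z in Hz0.
  assert (Hzc : cont_on a b z).
  { intros t Ht. exact (has_deriv_within_cont a b _ t _ (Hz0 t Ht)). }
  assert (Hxc : forall k, cont_on a b (fun t => x t k)) by (intros k; apply C1_on_cont, Hx).
  assert (Hvc : forall k, cont_on a b (fun t => v t k)) by (intros k; apply C1_on_cont, Hcx).
  pose proof HL as [_ [_ [HLx [HLv [_ HLz]]]]].
  destruct (cont_on_extend a b _ Hle (cont_on_along_curve n a b x v z _ Hxc Hvc Hzc HLz))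
    as [B [HB EB]].
  destruct (cont_on_extend a b _ Hle (cont_on_along_curve n a b x v z _ Hxc Hvc Hzc (proj2 (HLx j))))
    as [Px [HPx EPx]].
  destruct (cont_on_extend a b _ Hle (cont_on_along_curve n a b x v z _ Hxc Hvc Hzc (proj2 (HLv j))))
    as [Pv [HPv EPv]].
  set (lam := fun t => exp (- RInt B a t)).
  assert (Elam : forall t, a <= t <= b -> lambda t = lam t).
  { intros t Ht. unfold lambda, lam. do 2 f_equal. apply (RInt_ext (V := R_CompleteNormedModule)).
    intros s Hs. rewrite Rmin_left in Hs; [|lra]. rewrite Rmax_right in Hs; [|lra].
    symmetry. apply EB. lra. }
  assert (Hlam : forall t, continuous lam t).
  { intros t. unfold lam. apply (continuous_comp (fun t => - RInt B a t) exp).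
    - apply (continuous_opp (U := R_UniformSpace) (V := R_NormedModule) (fun t => RInt B a t)).
      exact (is_derive_continuous _ _ _ (is_derive_prim B a t HB)).
    - apply continuity_pt_filterlim, derivable_continuous_pt, derivable_pt_exp. }
  destruct (HRLc j) as [D' [HD'c HD']].
  pose proof (Gamma_pos _ (Halpha j)) as HG.
  (* The given D need not be known to be continuous. Uniqueness of relative derivatives and
     Gamma(1-alpha_j) being nonzero identify it with the continuous D'. *)
  assert (ED : forall t, a <= t <= b -> D t = D' t).
  { intros t Ht.
    pose proof (has_deriv_within_unique a b _ t _ _ Hab Ht (HD t Ht) (HD' t Ht)) as E.
    apply (Rmult_eq_reg_l (- Gamma (1 - alpha j))); [exact E|lra]. }
  intros t Ht. rewrite ED; [|exact Ht]. rewrite Elam; [|exact Ht]. rewrite -EPx; [|exact Ht].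
  apply (fractional_fundamental_lemma (fun t => lam t * Px t) (fun t => lam t * Pv t)
    (fun t => lambda t * dLv L j t (x t) (v t) (z t)) D' (alpha j) a b); try assumption.
  - apply Halpha.
  - intros s. apply (continuous_mult (K := R_AbsRing) lam Px); auto.
  - intros s. apply (continuous_mult (K := R_AbsRing) lam Pv); auto.
  - intros s Hs. rewrite Elam; [|exact Hs]. now rewrite EPv.
  - intros h Hh Hch Ha Hb.
    set (eta := single_variation j h).
    pose proof (Hext eta (variation_single alpha a b j h Hab Halpha Hh Hch Ha Hb)) as Hstat.
    destruct (cont_on_extend a b _ Hle (C1_on_cont _ _ _ Hh)) as [hc [Hhc Ehc]].
    destruct (cont_on_extend a b _ Hle (C1_on_cont _ _ _ Hch)) as [kc [Hkc Ekc]].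
    assert (HA : forall t, continuous (fun t => Px t * hc t + Pv t * kc t) t).
    { intros s. apply (continuous_plus (U := R_UniformSpace) (V := R_NormedModule)
        (fun t => Px t * hc t) (fun t => Pv t * kc t)).
      - apply (continuous_mult (K := R_AbsRing) Px hc); auto.
      - apply (continuous_mult (K := R_AbsRing) Pv kc); auto. }
    (* [zsol] is known to solve the Cauchy problem only along admissible curves, so each perturbed
       curve has to be admissible before its equation can be used. *)
    assert (Hadme : forall e, admissible alpha a b xa xb (perturb x eta e)).
    { intros e. now apply admissible_perturb_single. }
    assert (Hfv : is_derive (fun e => zsol (perturb x eta e) b) 0
      (RInt (fun t => exp (- RInt B a t) * (Px t * hc t + Pv t * kc t)) a b / exp (- RInt B a b))).
    { apply (first_variation n a b L j x v h (caputo (alpha j) a h)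
        (fun e => zsol (perturb x eta e)) za (fun t => Px t * hc t + Pv t * kc t) B); auto.
      - now apply C1_on_cont.
      - now apply C1_on_cont.
      - intros e. apply (Hsol _ (Hadme e)).
      - intros e s Hs. pose proof (proj2 (Hsol _ (Hadme e)) s Hs) as K.
        unfold eta in K at 2 3. rewrite perturb_single in K.
        rewrite (caputo_perturb_single alpha a b j h Hab Halpha Hh) in K; [exact K|exact Hx|exact Hs].
      - intros s Hs. rewrite perturb_0. fold z. rewrite EPx; [|exact Hs]. rewrite EPv; [|exact Hs].
        rewrite Ehc; [|exact Hs]. now rewrite Ekc.
      - intros s Hs. rewrite perturb_0. now apply EB. }
    rewrite (is_derive_unique _ _ _ Hfv) in Hstat.
    (* Stationarity kills the quotient in [first_variation]; its denominator is an exponential, so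
       the numerator vanishes. *)
    assert (E0 : RInt (fun t => exp (- RInt B a t) * (Px t * hc t + Pv t * kc t)) a b = 0).
    { pose proof (exp_pos (- RInt B a b)). apply Rmult_integral in Hstat.
      destruct Hstat as [E|E]; [exact E|]. exfalso. revert E. apply Rinv_neq_0_compat. lra. }
    rewrite -E0. apply (RInt_ext (V := R_CompleteNormedModule)). intros s Hs.
    rewrite Rmin_left in Hs; [|lra]. rewrite Rmax_right in Hs; [|lra].
    rewrite Ehc; [|lra]. rewrite Ekc; [|lra]. fold (lam s). simpl. ring.
Qed.
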